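(* Let $(X,\mu)$ be a standard non-atomic probability space. Let $\mathcal{BS}$ be the set of all bi-stochastic operators on $L^2(X,\mu)$, endowed with the weak operator topology. Let $\mathcal{T}\subset\mathcal{BS}$ be the set of Koopman operators of all measure-preserving transformations on $(X,\mu)$, and let $\mathcal{T}_{\mathrm{inv}}\subset\mathcal{T}$ be the set of Koopman operators of all invertible measure-preserving transformations on $(X,\mu)$. Then both $\mathcal{T}_{\mathrm{inv}}$ and $\mathcal{T}$ are dense $G_\delta$ subsets of $\mathcal{BS}$.
   Context: A linear operator $P$ on $L^2(X,\mu)$ (real or complex scalars) is called bi-stochastic if $P\mathbf{1}=P^*\mathbf{1}=\mathbf{1}$, where $\mathbf{1}$ is the constant function $1$, and $P$ is positive, i.e. $Pf\ge 0$ for every $f\ge 0$ (such operators are bounded, indeed contractive). A measure-preserving transformation on $(X,\mu)$ is a measurable map $T:X\to X$ with $\mu(T^{-1}(A))=\mu(A)$ for every measurable $A\subset X$; it need not be invertible. Its Koopman operator on $L^2(X,\mu)$ is $(Tf)(x):=f(Tx)$, which is a bi-stochastic isometry. A transformation $T$ is called invertible if it is essentially invertible, i.e. there is a measure-preserving $S:X\to X$ with $S\circ T=T\circ S=\mathrm{id}$ $\mu$-almost everywhere; equivalently, its Koopman operator is invertible (unitary). In the weak operator topology, $P_\alpha\to P$ iff $\langle P_\alpha f,g\rangle\to\langle Pf,g\rangle$ for all $f,g\in L^2(X,\mu)$. *)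

(* Defs.v *)
From HB Require Import structures.
From mathcomp Require Import all_boot all_order all_algebra.
From mathcomp Require Import generic_quotient ring_quotient.
From mathcomp Require Import all_classical all_reals all_analysis.
From mathcomp Require Import measurable_realfun borel_hierarchy complex.

Set Implicit Arguments.
Unset Strict Implicit.
Unset Printing Implicit Defensive.

Import Order.TTheory GRing.Theory Num.Theory.
Import numFieldNormedType.Exports.

Local Open Scope classical_set_scope.
Local Open Scope ring_scope.
Local Open Scope quotient_scope.

(* The spaces L^2(X, mu) are taken over R or over R[i]; both cases are handled
   at once, [k : scalar_kind] selecting the field.  In R[i] the order [0 <= z]
   means that z is real and nonnegative, and the topology is the one given by
   the modulus. *)
Variant scalar_kind := RealScalars | ComplexScalars.

Section scalars.
Variable R : realType.

Definition scalar_field (k : scalar_kind) : numFieldType :=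
  match k with RealScalars => R | ComplexScalars => R[i] end.

Definition scalar_mk (k : scalar_kind) : R -> R -> scalar_field k :=
  match k return R -> R -> scalar_field k with
  | RealScalars => fun a _ => a
  | ComplexScalars => fun a b => Complex a b
  end.

Definition scalar_re (k : scalar_kind) : scalar_field k -> R :=
  match k return scalar_field k -> R with
  | RealScalars => fun a => a
  | ComplexScalars => fun z => complex.Re z
  end.

Definition scalar_im (k : scalar_kind) : scalar_field k -> R :=
  match k return scalar_field k -> R with
  | RealScalars => fun=> 0
  | ComplexScalars => fun z => complex.Im z
  end.

Definition scalar_conj (k : scalar_kind) (z : scalar_field k) : scalar_field k :=
  scalar_mk k (scalar_re z) (- scalar_im z).

Lemma scalar_reD k (z w : scalar_field k) :
  scalar_re (z + w) = scalar_re z + scalar_re w.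
Proof. by case: k z w => //= -[a b] [c d]. Qed.

Lemma scalar_imD k (z w : scalar_field k) :
  scalar_im (z + w) = scalar_im z + scalar_im w.
Proof. by case: k z w => [z w|[a b] [c d]] //=; rewrite addr0. Qed.

Lemma scalar_reM k (z w : scalar_field k) :
  scalar_re (z * w) = scalar_re z * scalar_re w - scalar_im z * scalar_im w.
Proof. by case: k z w => [z w|[a b] [c d]] //=; rewrite mul0r subr0. Qed.

Lemma scalar_imM k (z w : scalar_field k) :
  scalar_im (z * w) = scalar_re z * scalar_im w + scalar_im z * scalar_re w.
Proof. by case: k z w => [z w|[a b] [c d]] //=; rewrite mulr0 mul0r addr0. Qed.

Lemma scalar_re0 k : scalar_re (0 : scalar_field k) = 0. Proof. by case: k. Qed.
Lemma scalar_im0 k : scalar_im (0 : scalar_field k) = 0. Proof. by case: k. Qed.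

Lemma scalar_re_mul_conj k (z w : scalar_field k) : scalar_re (z * scalar_conj w) =
  scalar_re z * scalar_re w + scalar_im z * scalar_im w.
Proof.
case: k z w => [z w|[a b] [c d]] /=; first by rewrite mul0r addr0.
by rewrite mulrN opprK.
Qed.

Lemma scalar_im_mul_conj k (z w : scalar_field k) : scalar_im (z * scalar_conj w) =
  scalar_im z * scalar_re w - scalar_re z * scalar_im w.
Proof.
case: k z w => [z w|[a b] [c d]] /=; first by rewrite mul0r mulr0 subr0.
by rewrite mulrN addrC.
Qed.

End scalars.
Arguments scalar_re {R k}.
Arguments scalar_im {R k}.
Arguments scalar_conj {R k}.

Section L2.
Context d (X : measurableType d) (R : realType).
Variables (mu : probability X R) (k : scalar_kind).
Local Notation K := (scalar_field R k).

(* [f] is square integrable iff its real and imaginary parts are measurable and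
   square integrable (the imaginary part is 0 over R). *)
Definition sqintegrable : {pred X -> K} := fun f =>
  (scalar_re \o f \in Lfun mu 2%:E) && (scalar_im \o f \in Lfun mu 2%:E).

Lemma sqintegrable_submod : submod_closed sqintegrable.
Proof.
have [L0 LS] := Lfun_submod_closed mu (lee1n 2).
split.
  apply/andP; split; rewrite [X in X \in _](_ : _ = 0) //; apply/funext => x.
    exact: scalar_re0.
  exact: scalar_im0.
move=> a f g /andP[f1 f2] /andP[g1 g2]; apply/andP; split.
  rewrite [X in X \in _](_ : _ = scalar_re a *: (scalar_re \o f) +
     ((- scalar_im a) *: (scalar_im \o f) + (scalar_re \o g))).
    by apply: (LS _ _ _ _ (LS _ _ _ _ _)).
  apply/funext => x; rewrite /= scalar_reD scalar_reM !fctE /=.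
  by rewrite addrA; congr (_ + _ + _); rewrite -mulNr.
rewrite [X in X \in _](_ : _ = scalar_re a *: (scalar_im \o f) +
     (scalar_im a *: (scalar_re \o f) + (scalar_im \o g))).
  by apply: (LS _ _ _ _ (LS _ _ _ _ _)).
by apply/funext => x; rewrite /= scalar_imD scalar_imM !fctE /= addrA.
Qed.

HB.instance Definition _ :=
  GRing.isSubmodClosed.Build _ _ sqintegrable sqintegrable_submod.

Record sqfun := SqFun { sqfun_fun :> X -> K; _ : sqfun_fun \in sqintegrable }.
HB.instance Definition _ := [isSub for sqfun_fun].
HB.instance Definition _ := [Choice of sqfun by <:].
HB.instance Definition _ := [SubChoice_isSubLmodule of sqfun by <:].

Definition aenull : {pred sqfun} :=
  fun f => `[< {ae mu, forall x, f x = 0} >].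

Lemma aenull_submod : submod_closed aenull.
Proof.
split; first by apply/asboolP; apply: aeW => x.
move=> a f g /asboolP f0 /asboolP g0; apply/asboolP.
apply: filterS2 f0 g0 => x fx gx.
by rewrite -[LHS]/(a *: f x + g x) fx gx scaler0 addr0.
Qed.

HB.instance Definition _ :=
  GRing.isSubmodClosed.Build _ _ aenull aenull_submod.

Definition L2 : Type := {ideal_quot aenull}.
HB.instance Definition _ := GRing.Zmodule.on L2.

(* [L2] is the quotient of the square integrable functions by a.e. equality; an
   element of [L2] coerces to one of its representatives, so pointwise
   statements on elements of [L2] are only meaningful a.e. *)
Definition toL2 (f : sqfun) : L2 := \pi_({ideal_quot aenull}) f.
Definition L2_fun (f : L2) : X -> K := repr (f : {ideal_quot aenull}).
Coercion L2_fun : L2 >-> Funclass.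

Lemma toL2K (f : sqfun) : {ae mu, forall x, toL2 f x = f x}.
Proof.
have : \pi_({ideal_quot aenull}) (repr (toL2 f : {ideal_quot aenull})) = \pi f.
  exact: reprK.
move=> /eqP; rewrite -Quotient.idealrBE => /asboolP.
by apply: filterS => x h; apply/eqP; rewrite -subr_eq0; apply/eqP.
Qed.

Lemma L2_sqintegrable (f : L2) : (f : X -> K) \in sqintegrable.
Proof. exact: valP (repr (f : {ideal_quot aenull})). Qed.

Lemma L2P (f g : L2) : {ae mu, forall x, f x = g x} -> f = g.
Proof.
move=> fg; rewrite -[f]reprK -[g]reprK; apply/eqP.
rewrite -Quotient.idealrBE; apply/asboolP.
by apply: filterS fg => x h; apply/eqP; rewrite subr_eq0; apply/eqP.
Qed.

Lemma toL2_eq (f g : sqfun) : {ae mu, forall x, f x = g x} -> toL2 f = toL2 g.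
Proof.
move=> fg; apply/eqP; rewrite -Quotient.idealrBE; apply/asboolP.
by apply: filterS fg => x h; apply/eqP; rewrite subr_eq0; apply/eqP.
Qed.

Lemma toL2D (f g : sqfun) : toL2 (f + g) = toL2 f + toL2 g.
Proof. exact: pi_addr. Qed.

Lemma toL2_repr (f : L2) : toL2 (repr (f : {ideal_quot aenull})) = f.
Proof. exact: reprK. Qed.

Definition L2_scale (a : K) (f : L2) : L2 :=
  toL2 (a *: repr (f : {ideal_quot aenull})).

Lemma L2_scaleE a (f : sqfun) : L2_scale a (toL2 f) = toL2 (a *: f).
Proof.
apply: toL2_eq; apply: filterS (toL2K f) => x h.
by rewrite -[LHS]/(a *: (toL2 f x)) h.
Qed.

Lemma L2_scaleA a b f : L2_scale a (L2_scale b f) = L2_scale (a * b) f.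
Proof. by rewrite -(toL2_repr f) !L2_scaleE scalerA. Qed.

Lemma L2_scale1 : left_id 1 L2_scale.
Proof. by move=> f; rewrite -(toL2_repr f) L2_scaleE scale1r. Qed.

Lemma L2_scaleDr : right_distributive L2_scale +%R.
Proof.
move=> a f g; rewrite -(toL2_repr f) -(toL2_repr g) -toL2D !L2_scaleE.
by rewrite -toL2D scalerDr.
Qed.

Lemma L2_scaleDl f : {morph L2_scale^~ f : a b / a + b}.
Proof. by move=> a b; rewrite -(toL2_repr f) !L2_scaleE -toL2D scalerDl. Qed.

HB.instance Definition _ := GRing.Zmodule_isLmodule.Build K L2
  L2_scaleA L2_scale1 L2_scaleDr L2_scaleDl.

Lemma L2_addE (f g : L2) : {ae mu, forall x, (f + g : L2) x = f x + g x}.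
Proof.
have := toL2K (repr (f : {ideal_quot aenull}) + repr (g : {ideal_quot aenull})).
by rewrite toL2D !toL2_repr.
Qed.

Lemma L2_scalerE a (f : L2) : {ae mu, forall x, (a *: f : L2) x = a * f x}.
Proof. exact: toL2K. Qed.

Lemma sqintegrable_cst1 : (fun=> 1 : K) \in sqintegrable.
Proof. by apply/andP; split; exact: Lfun_cst. Qed.

Definition L2_one : L2 := toL2 (SqFun sqintegrable_cst1).

Definition L2_inner (f g : L2) : K :=
  scalar_mk k (\int[mu]_x scalar_re (f x * scalar_conj (g x)))
              (\int[mu]_x scalar_im (f x * scalar_conj (g x))).

Definition operator : Type := {linear L2 -> L2}.
HB.instance Definition _ := gen_eqMixin operator.
HB.instance Definition _ := gen_choiceMixin operator.

(* Linear operators carry the weak operator topology: the coarsest topology for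
   which every P |-> <P f, g> is continuous (see [operator_cvgP]). *)
Definition matrix_coef (P : {linear L2 -> L2}) : {ptws L2 * L2 -> K} :=
  fun fg => L2_inner (P fg.1) fg.2.

HB.instance Definition _ :=
  Topological.copy operator (initial_topology matrix_coef).

Lemma operator_cvgP (F : set_system operator) (P : operator) : Filter F ->
  F --> P <->
  forall f g : L2, L2_inner ((Q : {linear L2 -> L2}) f) g @[Q --> F] -->
    L2_inner ((P : {linear L2 -> L2}) f) g.
Proof.
move=> FF; split=> [FP f g|FP].
  pose e := fun h : {ptws L2 * L2 -> K} => h (f, g).
  have ce : {for matrix_coef P, continuous e}.
    exact: (@proj_continuous _ (fun=> K : topologicalType) (f, g)).
  have cm : {for P, continuous (matrix_coef : operator -> _)}.
    exact: initial_continuous.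
  exact: cvg_trans (cvg_app _ FP) (cvg_comp _ _ cm ce).
have cF : (matrix_coef : operator -> _) @ F --> matrix_coef P.
  apply/cvg_sup => -[f g].
  rewrite cvg_image; last by rewrite eqEsubset; split=> v // _; exists (cst v).
  move=> W /= /(FP f g) FW; exists (@^~ (f, g) @^-1` W) => //.
  by rewrite eqEsubset; split => [j [? + <-//]|j Wj]; exists (fun _ => j).
move=> A [_ [[B oB <-] BP] BA].
apply: filterS BA _; apply: cF.
exact: open_nbhs_nbhs.
Qed.

Definition positive_operator (P : {linear L2 -> L2}) : Prop :=
  forall f : L2, {ae mu, forall x, 0 <= f x} -> {ae mu, forall x, 0 <= (P f : L2) x}.

(* h = P^* g.  Boundedness is not required of P: a positive operator on L^2 is
   automatically bounded. *)
Definition adjoint_graph (P : {linear L2 -> L2}) (g h : L2) : Prop :=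
  forall f : L2, L2_inner (P f) g = L2_inner f h.

Definition bistochastic (P : {linear L2 -> L2}) : Prop :=
  [/\ positive_operator P, P L2_one = L2_one & adjoint_graph P L2_one L2_one].

Definition BS : set operator := [set P | bistochastic P].

Definition measure_preserving (T : X -> X) : Prop :=
  measurable_fun setT T /\
  forall A, measurable A -> mu (T @^-1` A) = mu A.

Definition essentially_invertible (T : X -> X) : Prop :=
  exists2 S : X -> X, measure_preserving S &
    {ae mu, forall x, S (T x) = x /\ T (S x) = x}.

Definition is_koopman (T : X -> X) (P : {linear L2 -> L2}) : Prop :=
  forall f : L2, {ae mu, forall x, (P f : L2) x = f (T x)}.

(* [koopman] and [koopman_inv] are subsets of [BS] viewed as a space, with the
   subspace topology.  Every Koopman operator does lie in [BS]
   ([is_koopman_bistochastic], [koopman_in_BS]), so nothing is lost by only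
   collecting the members of [BS]. *)
Definition koopman : set BS :=
  [set P | exists2 T, measure_preserving T & is_koopman T (\val P)].

Definition koopman_inv : set BS :=
  [set P | exists2 T, measure_preserving T /\ essentially_invertible T &
                      is_koopman T (\val P)].

Definition nonatomic : Prop :=
  forall A, measurable A -> (0 < mu A)%E ->
    exists B, [/\ measurable B, B `<=` A, (0 < mu B)%E & (mu B < mu A)%E].

(* A Hausdorff complete pseudometric space is a complete metric space. *)
Definition polish (Y : completePseudoMetricType R) : Prop :=
  hausdorff_space Y /\ exists2 D : set Y, countable D & dense D.

Definition standard_borel : Prop :=
  exists (Y : completePseudoMetricType R) (phi : X -> Y),
    [/\ polish Y, bijective phi &
        @measurable d X = [set phi @^-1` B | B in <<s @open Y >>]].

Section koopman_operator.
Variables (T : X -> X) (Tmp : measure_preserving T).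

Lemma mp_ge0_integral (g : X -> \bar R) : measurable_fun setT g ->
  (forall x, 0 <= g x)%E -> (\int[mu]_x g (T x) = \int[mu]_x g x)%E.
Proof.
move=> mg g0; have [mT mpT] := Tmp.
transitivity (\int[pushforward mu T]_x g x)%E.
  by rewrite ge0_integral_pushforward.
by apply: eq_measure_integral => A mA _; exact: mpT.
Qed.

Lemma mp_ae (Q : set X) : {ae mu, forall x, Q x} -> {ae mu, forall x, Q (T x)}.
Proof.
have [mT mpT] := Tmp; case=> N [mN N0 QN]; exists (T @^-1` N); split.
- by rewrite -[X in measurable X]setTI; exact: mT.
- by rewrite mpT.
- by move=> x /= /(QN (T x)).
Qed.

Lemma mp_integral (g : X -> R) : g \in Lfun mu 1 ->
  \int[mu]_x g (T x) = \int[mu]_x g x.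
Proof.
move=> /Lfun1_integrable ig.
pose h := EFin \o g.
have mh : measurable_fun setT h by exact: measurable_int ig.
have pos := mp_ge0_integral (measurable_funepos mh) (fun=> funepos_ge0 _ _).
have neg := mp_ge0_integral (measurable_funeneg mh) (fun=> funeneg_ge0 _ _).
suff e : (\int[mu]_x h (T x) = \int[mu]_x h x)%E.
  by rewrite /Rintegral e.
rewrite [LHS]integralE [RHS]integralE.
congr (_ - _)%E; [rewrite -pos | rewrite -neg];
  by apply: eq_integral => x _; rewrite unlock.
Qed.

Lemma mp_Lfun (g : X -> R) : g \in Lfun mu 2%:E -> g \o T \in Lfun mu 2%:E.
Proof.
have [mT mpT] := Tmp; case/andP => /set_mem/= mg /set_mem fg.
apply/andP; split; apply/mem_set => /=; first exact: measurableT_comp.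
have mg2 : measurable_fun [set: X] (fun x => (`|(g x)%:E| `^ 2)%E).
  apply/measurable_EFinP.
  by apply: (@measurableT_comp _ _ _ _ _ _ (fun x : R => x `^ 2)%R) => //;
    exact/measurableT_comp.
move: fg; rewrite /finite_norm unlock /=.
by rewrite -(mp_ge0_integral mg2) // => x; exact: poweR_ge0.
Qed.

Lemma koopman_sqintegrable (f : L2) :
  (fun x => f (T x)) \in sqintegrable.
Proof.
by have /andP[f1 f2] := L2_sqintegrable f; apply/andP; split;
  [exact: (mp_Lfun f1) | exact: (mp_Lfun f2)].
Qed.

Definition koopman_fun (f : L2) : L2 :=
  toL2 (SqFun (koopman_sqintegrable f)).

Lemma koopman_funE (f : L2) :
  {ae mu, forall x, koopman_fun f x = f (T x)}.
Proof. exact: toL2K. Qed.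

Lemma koopman_fun_linear : linear koopman_fun.
Proof.
move=> a f g; apply: L2P.
have H1 := L2_addE (a *: koopman_fun f) (koopman_fun g).
have H2 := L2_scalerE a (koopman_fun f).
have H3 := mp_ae (L2_addE (a *: f) g).
have H4 := mp_ae (L2_scalerE a f).
near=> x.
rewrite (near (koopman_funE (a *: f + g)) x) //.
rewrite (near H3 x) // (near H4 x) // (near H1 x) // (near H2 x) //.
by rewrite (near (koopman_funE f) x) // (near (koopman_funE g) x).
Unshelve. all: by end_near. Qed.

End koopman_operator.

Lemma ae_eq_Rintegral (g h : X -> R) :
  measurable_fun [set: X] g -> measurable_fun [set: X] h ->
  {ae mu, forall x, g x = h x} -> \int[mu]_x g x = \int[mu]_x h x.
Proof.
move=> mg mh gh; rewrite /Rintegral; congr (fine _); apply: ae_eq_integral => //.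
- exact/measurable_EFinP.
- exact/measurable_EFinP.
- by apply: filterS gh => x -> _.
Qed.

Lemma sqintegrable_re (f : X -> K) : f \in sqintegrable ->
  scalar_re \o f \in Lfun mu 2%:E.
Proof. by case/andP. Qed.

Lemma sqintegrable_im (f : X -> K) : f \in sqintegrable ->
  scalar_im \o f \in Lfun mu 2%:E.
Proof. by case/andP. Qed.

Lemma Lfun_measurable (g : X -> R) :
  g \in Lfun mu 2%:E -> measurable_fun [set: X] g.
Proof. by case/andP => /set_mem. Qed.

Lemma L2_inner_one (f : L2) : L2_inner f L2_one =
  scalar_mk k (\int[mu]_x scalar_re (f x)) (\int[mu]_x scalar_im (f x)).
Proof.
have one1 := toL2K (SqFun (sqintegrable_cst1)).
have mre (g : L2) := Lfun_measurable (sqintegrable_re (L2_sqintegrable g)).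
have mim (g : L2) := Lfun_measurable (sqintegrable_im (L2_sqintegrable g)).
have re1 : scalar_re (1 : K) = 1 by case: (k).
have im1 : scalar_im (1 : K) = 0 by case: (k).
rewrite /L2_inner; congr (scalar_mk _ _ _); apply: ae_eq_Rintegral.
- under eq_fun do rewrite scalar_re_mul_conj.
  apply: measurable_funD; apply: measurable_funM.
  + exact: mre.
  + exact: mre.
  + exact: mim.
  + exact: mim.
- exact: mre.
- apply: filterS one1 => x ->.
  by rewrite scalar_re_mul_conj re1 im1 mulr0 addr0 mulr1.
- under eq_fun do rewrite scalar_im_mul_conj.
  apply: measurable_funB; apply: measurable_funM.
  + exact: mim.
  + exact: mre.
  + exact: mre.
  + exact: mim.
- exact: mim.
- apply: filterS one1 => x ->.
  by rewrite scalar_im_mul_conj re1 im1 mulr0 subr0 mulr1.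
Qed.

Lemma is_koopman_bistochastic T (P : {linear L2 -> L2}) :
  measure_preserving T -> is_koopman T P -> bistochastic P.
Proof.
move=> Tmp PT; split.
- by move=> f /(mp_ae Tmp); apply: filterS2 (PT f) => x ->.
- apply: L2P; have H := toL2K (SqFun (sqintegrable_cst1)).
  by apply: filterS3 (PT L2_one) H (mp_ae Tmp H) => x -> -> ->.
- move=> f; rewrite !L2_inner_one; congr (scalar_mk _ _ _).
  + have h := sqintegrable_re (L2_sqintegrable f).
    have h1 := Lfun_subset12 (fin_num_measure mu _ measurableT) h.
    rewrite -(mp_integral Tmp h1).
    apply: ae_eq_Rintegral.
    * exact: Lfun_measurable (sqintegrable_re (L2_sqintegrable _)).
    * exact: Lfun_measurable (mp_Lfun Tmp h).
    * by apply: filterS (PT f) => x ->.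
  + have h := sqintegrable_im (L2_sqintegrable f).
    have h1 := Lfun_subset12 (fin_num_measure mu _ measurableT) h.
    rewrite -(mp_integral Tmp h1).
    apply: ae_eq_Rintegral.
    * exact: Lfun_measurable (sqintegrable_im (L2_sqintegrable _)).
    * exact: Lfun_measurable (mp_Lfun Tmp h).
    * by apply: filterS (PT f) => x ->.
Qed.

Lemma koopman_in_BS T : measure_preserving T -> exists P : BS, is_koopman T (\val P).
Proof.
move=> Tmp.
pose P : {linear L2 -> L2} := HB.pack (koopman_fun Tmp)
  (GRing.isLinear.Build K L2 L2 *:%R (koopman_fun Tmp) (koopman_fun_linear Tmp)).
have PT : is_koopman T P by move=> f; exact: koopman_funE.
by exists (SigSub (mem_set (is_koopman_bistochastic Tmp PT))).
Qed.

End L2.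

Arguments L2_one {d X R} mu k.
Arguments BS {d X R} mu k.
Arguments koopman {d X R} mu k.
Arguments koopman_inv {d X R} mu k.

(* Main.v *)
(* A bi-stochastic operator P is encoded by the set function
   gamma(A, B) = <P 1_A, 1_B>, a coupling of mu with itself, and gamma determines P.
   P is a Koopman operator iff every measurable A has an E with
   gamma(A, E^c) = gamma(A^c, E) = 0: such pairs (A, E) form a homomorphism of the
   measure algebra, which on a standard Borel space is induced by a point map T
   (obtained as a limit of centres of small balls of the Polish space), with
   T^-1(A) = E.  T is invertible iff moreover every E comes from some A.  It is
   enough to have E for the sets A of a countable generating family, and only up
   to error 1/m, by a Borel-Cantelli argument; for fixed A, E and m this is an open
   condition on P, which gives both G_delta statements.

   For density, given finitely many sets, atomlessness allows to cut the atoms of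
   the algebra they generate into pieces whose measures are the values of gamma on
   pairs of atoms.  Measurable sets of equal measure are isomorphic, through the
   measure of initial segments for a Borel coding of X by reals, so some invertible
   T permutes the pieces in such a way that mu(T^-1(A) `&` B) = gamma(A, B) for all
   the given sets.  The contraction bound
   <P a, b> <= (|a|^2 + |b|^2) / 2 for nonnegative a, b then passes from indicators
   to all of L^2, uniformly in P. *)
Require Import Defs.
From mathcomp Require Import all_boot all_order all_algebra.
From mathcomp Require Import all_classical all_reals all_analysis.
From mathcomp Require Import borel_hierarchy measurable_realfun complex.
From mathcomp Require Import ring lra.

Set Implicit Arguments.
Unset Strict Implicit.
Unset Printing Implicit Defensive.

Import Order.TTheory GRing.Theory Num.Theory.
Import numFieldNormedType.Exports.

Local Open Scope classical_set_scope.
Local Open Scope ring_scope.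

(** * Measure algebra homomorphisms and point maps *)

Section sigma_closed.
Context {T : Type}.

(** For density, agreement with P on finitely many sets is obtained exactly: atoms are split into
    pieces of arbitrary real measures, so no discretisation enters. The estimate left to make is the
    passage from indicators to L^2. Since positivity is assumed and not boundedness, the bound must
    be earned: it comes from Jensen's inequality (P a)^2 <= P(a^2), which makes sense only when a^2
    is itself in L^2, and is extended to all a by truncation. Both scalar fields are treated at once
    because a positive operator sends real functions to real functions, so that P is read off the
    real form <P a, b>. The relation between A and E is symmetric in form: transposing gamma amounts
    to replacing P by its adjoint. Surjectivity, the extra condition for invertible maps, is
    therefore the totality argument applied to the transposed coupling. *)

Definition sigma_closed (G : set (set T)) :=
  (forall A, G A -> G (~` A)) /\
  (forall A : (set T)^nat, (forall n, G (A n)) -> G (\bigcup_n A n)).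

Lemma sigma_closed_algebra (G : set (set T)) A :
  G A -> sigma_closed G -> sigma_algebra setT G.
Proof.
move=> GA [GC GU]; split=> [|B GB|B GB]; [|by rewrite setTD; exact: GC|exact: GU].
rewrite -setCT -(setUv A) -bigcup2E; apply/GC/GU => -[|[|n]] //=; first exact: GC.
(* [bigcup2] pads its sequence with the empty set, the very set whose membership is in question;
   here the complement of [A] does the padding. *)
have -> : set0 = ~` \bigcup_n (fun n => if n is 0 then A else ~` A) n :> set T.
  apply/esym/seteqP; split => // x /= xN; apply: xN.
  by have [xA|xA] := pselect (A x); [exists 0|exists 1].
by apply/GC/GU => -[|m] //=; exact: GC.
Qed.

End sigma_closed.

Notation null_equal mu A B := {ae mu, forall x, A x <-> B x}.

Section null_equal.
Context d (X : measurableType d) (R : realType) (mu : probability X R).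

Lemma null_equal_refl A : null_equal mu A A.
Proof. exact: aeW. Qed.

Lemma null_equal_trans B A C :
  null_equal mu A B -> null_equal mu B C -> null_equal mu A C.
Proof.
by move=> AB BC; apply: filterS2 AB BC => x AB BC; split => [/AB/BC|/BC/AB].
Qed.

Lemma null_equalC A B : null_equal mu A B -> null_equal mu (~` A) (~` B).
Proof.
by move=> AB; apply: filterS AB => x AB; split; apply: contra_not => /AB.
Qed.

Lemma null_equal_bigcup (A B : (set X)^nat) :
  (forall n, null_equal mu (A n) (B n)) -> null_equal mu (\bigcup_n A n) (\bigcup_n B n).
Proof.
move=> AB; apply: filterS (ae_foralln AB) => x {}AB.
by split=> -[n _ /AB ?]; exists n.
Qed.

Lemma null_equal_measure A B : measurable A -> measurable B ->
  null_equal mu A B -> mu A = mu B.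
Proof.
move=> mA mB [N [mN N0 ABN]].
have le C D : measurable C -> measurable D -> C `\` D `<=` N -> (mu C <= mu D)%E.
  move=> mC mD CDN; rewrite (le_trans (le_measure mu _ _ (_ : C `<=` D `|` N)))//.
  - by rewrite inE.
  - by rewrite inE; exact: measurableU.
  - by move=> x Cx; have [Dx|Dx] := pselect (D x); [left|right; exact: CDN].
  - by apply: (@le_trans _ _ (mu D + mu N)%E); [exact: measureU2|rewrite N0 adde0].
by apply/eqP; rewrite eq_le !le// => x [Ax Bx]; apply: ABN => /= AB; tauto.
Qed.

Lemma null_equal_ae A : measurable A -> mu (~` A) = 0%E -> {ae mu, forall x, A x}.
Proof. by move=> mA A0; exists (~` A); split => //; exact: measurableC. Qed.

End null_equal.

Section realization.
Context d (X : measurableType d) (R : realType) (mu : probability X R).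

(* A sub-sigma-algebra of pairs of measurable sets with equal measure: when
   every measurable [A] is related to some [E], this is a measure-preserving
   homomorphism of the measure algebra. *)
Definition measure_relation (Rel : set X -> set X -> Prop) :=
  [/\ forall A E, Rel A E -> [/\ measurable A, measurable E & mu A = mu E],
      forall A E, Rel A E -> Rel (~` A) (~` E) &
      forall A E : (set X)^nat, (forall n, Rel (A n) (E n)) ->
        Rel (\bigcup_n A n) (\bigcup_n E n)].

Lemma measure_relation_sym Rel : measure_relation Rel ->
  measure_relation (fun A E => Rel E A).
Proof.
by move=> [R1 R2 R3]; split=> [A E /R1[]|A E /R2|A E /R3].
Qed.

Section relation_theory.
Variable Rel : set X -> set X -> Prop.
Hypothesis RelP : measure_relation Rel.

Lemma relU A B E F : Rel A E -> Rel B F -> Rel (A `|` B) (E `|` F).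
Proof.
move=> AE BF; have [_ _ RU] := RelP.
have eq2 (C D : set X) : C `|` D = \bigcup_n (if n is 0 then C else D).
  apply/seteqP; split=> [x [Cx|Dx]|x [[|n] _ ?]]; [by exists 0|by exists 1|..].
  - by left.
  - by right.
by rewrite !eq2; apply: RU => -[|n].
Qed.

Lemma relI A B E F : Rel A E -> Rel B F -> Rel (A `&` B) (E `&` F).
Proof.
move=> AE BF; have [_ RC _] := RelP.
by rewrite -[A `&` B]setCK -[E `&` F]setCK !setCI; apply/RC/relU; exact: RC.
Qed.

Lemma rel0 A E : Rel A E -> Rel set0 set0.
Proof.
move=> AE; have [_ RC _] := RelP.
by have := relI AE (RC _ _ AE); rewrite !setICr.
Qed.

(** A set and its complement meet in the empty set, so the part of one candidate outside the other
    is related to the empty set and has measure zero. *)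
Lemma rel_unique A E E' : Rel A E -> Rel A E' -> null_equal mu E E'.
Proof.
move=> AE AE'; have [Rm RC RU] := RelP.
have H F F' : Rel A F -> Rel A F' -> {ae mu, forall x, F' x -> F x}.
  move=> AF AF'; have := relI (RC _ _ AF) AF'; rewrite setICl => /Rm[_ m1].
  rewrite measure0 => m0; exists (~` F `&` F'); split => // x /= /not_implyP[].
  by [].
by apply: filterS2 (H _ _ AE AE') (H _ _ AE' AE) => x ? ?; split.
Qed.

End relation_theory.
End realization.

(** * Realisation of homomorphisms by limits in a Polish space *)

Section polish_basis.
Context d (X : measurableType d) (R : realType).
Context (Y : completePseudoMetricType R) (phi : X -> Y).
Hypothesis (Ypolish : polish Y) (phi_bij : bijective phi).
Hypothesis measurableE : @measurable d X = [set phi @^-1` B | B in <<s @open Y >>].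

Let radius (m : nat) : R := m.+1%:R^-1.

Let radius_gt0 m : 0 < radius m. Proof. by rewrite invr_gt0. Qed.

Let radius_small (e : R) : 0 < e -> \forall m \near \oo, radius m < e.
Proof. by move=> e0; exact: (near_infty_natSinv_lt (PosNum e0)). Qed.

Lemma polish_centers : exists y : nat -> Y,
  forall z e, 0 < e -> exists i, ball z e (y i).
Proof.
have [_ [D /countable_injP[f finj] Ddense]] := Ypolish.
exists (fun n => xget (phi point) [set y | D y /\ f y = n]) => z e e0.
have zO : (ball z e)^° !=set0 by exists z; exact: nbhsx_ballx.
have [z' [zz' Dz']] := Ddense _ zO (@open_interior _ _).
exists (f z'); case: xgetP => [y _ [Dy /finj yz']|/(_ z')]; last by case.
by rewrite yz' ?inE//; exact: interior_subset.
Qed.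

Let y := projT1 (cid polish_centers).

Let y_dense z e : 0 < e -> exists i, ball z e (y i).
Proof. exact: (projT2 (cid polish_centers)). Qed.

(** Interiors are taken because a ball of a pseudometric structure need not be open. *)
Definition basis m i : set X := phi @^-1` (ball (y i) (radius m))^°.

Let preimage_open U : open U -> measurable (phi @^-1` U).
Proof.
by move=> oU; rewrite measurableE; exists U => //; exact: sub_sigma_algebra.
Qed.

Lemma basis_measurable m i : measurable (basis m i).
Proof. by apply: preimage_open; exact: open_interior. Qed.

Lemma basis_ball m i x : basis m i x -> ball (y i) (radius m) (phi x).
Proof. exact: interior_subset. Qed.

Lemma basis_cover m x : exists i, basis m i x.
Proof.
have r2 : 0 < radius m / 2 by rewrite divr_gt0.
have [i xi] := y_dense (phi x) r2; exists i.
apply: filterS (nbhsx_ballx (phi x) _ r2) => z xz.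
by apply: ball_split xz; exact: ball_sym.
Qed.

(** The limit point constructed in [good_limit] is reached from the centre of a cell of radius
    [radius m] through two small errors; the doubled radius leaves room for them. *)
Let dbl m := radius m + radius m.

(** One [m] serves all [i]: a ball of radius [dbl m] that contains [p] stays within [4 * radius m]
    of [p], whatever its centre. *)
Lemma basis_inside U p : open U -> U p ->
  exists m, forall i, ball (y i) (dbl m) p -> ball (y i) (dbl m) `<=` U.
Proof.
move=> oU Up; have /nbhs_ballP[e /= e0 peU] : nbhs p U by exact: open_nbhs_nbhs.
have e4 : 0 < e / 4 by rewrite divr_gt0.
have [m _ /(_ m (leqnn _)) /= rm] := radius_small e4.
exists m => i ip z iz; apply: peU.
apply: (@le_ball _ _ _ (dbl m + dbl m)); last first.
  by apply: ball_triangle iz; exact: ball_sym.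
by move: rm; rewrite /dbl ltr_pdivlMr// => rm; lra.
Qed.

Definition decode n : nat * nat := odflt (0, 0)%N (unpickle n).

Lemma decodeK m i : decode (pickle (m, i)) = (m, i).
Proof. by rewrite /decode pickleK. Qed.

(** Applied to [basis], the union of these sets recovers the preimage of [U]. Applied to the sets
    related to the basis, it gives a set related to that preimage. *)
Let select (U : set Y) (F : nat -> nat -> set X) n : set X :=
  if `[< ball (y (decode n).2) (dbl (decode n).1) `<=` U >]
  then F (decode n).1 (decode n).2 else set0.

Let basis_dbl m i x : basis m i x -> ball (y i) (dbl m) (phi x).
Proof.
move=> /basis_ball; apply: le_ball; rewrite /dbl lerDl; exact/ltW/radius_gt0.
Qed.

Let open_selectP U F (T : X -> X) x : open U ->
  (forall m, exists i, F m i x) ->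
  (forall m i, F m i x -> ball (y i) (dbl m) (phi (T x))) ->
  U (phi (T x)) <-> (\bigcup_n select U F n) x.
Proof.
move=> oU Fcov Fball; split=> [UT|[n _]].
  have [m mU] := basis_inside oU UT; have [i Fi] := Fcov m.
  exists (pickle (m, i)) => //; rewrite /select decodeK/=.
  by case: asboolP => // -[]; apply/mU/Fball.
by rewrite /select; case: asboolP => // BU /Fball /BU.
Qed.

Let preimage_open_select U : open U -> phi @^-1` U = \bigcup_n select U basis n.
Proof.
move=> oU; have sel x : U (phi x) <-> (\bigcup_n select U basis n) x.
  by apply: (@open_selectP _ _ id) => // m; [exact: basis_cover|move=> i; exact: basis_dbl].
by apply/seteqP; split=> x /sel.
Qed.

Lemma basis_induction G : sigma_closed G -> (forall m i, G (basis m i)) ->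
  forall B, measurable B -> G B.
Proof.
move=> sG Gb B; rewrite measurableE => -[C + <-].
have [G0 GC GU] := sigma_closed_algebra (Gb 0 0)%N sG.
apply: (@smallest_sub _ _ _ [set C | G (phi @^-1` C)]) C => [|U oU /=].
  split=> [|A GA|A GA] /=.
  - by rewrite preimage_set0.
  - by rewrite setTD -preimage_setC; exact: sG.1.
  - by rewrite preimage_bigcup; exact: sG.2.
rewrite preimage_open_select//; apply: sG.2 => n; rewrite /select.
by case: ifP.
Qed.

Lemma basis_separates x x' : (forall m i, basis m i x <-> basis m i x') -> x = x'.
Proof.
move=> xx'; apply: (bij_inj phi_bij); apply/eqP/negPn/negP => nxx'.
have [+ _] := Ypolish; rewrite ball_hausdorff => /(_ _ _ nxx')[[r1 r2] /= /eqP].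
have [m mU] := basis_inside (@open_interior _ (ball (phi x) r1%:num))
  (nbhsx_ballx (phi x) r1%:num (gt0 r1)).
have [i xi] := basis_cover m x.
have /= := mU i (basis_dbl xi) _ (basis_dbl ((xx' m i).1 xi)).
by move=> /interior_subset xr1 /seteqP[/(_ (phi x')) + _]; apply; split => //; exact: ballxx.
Qed.

Section realize.
Variables (mu : probability X R) (Rel : set X -> set X -> Prop).
Hypothesis RelP : measure_relation mu Rel.
Hypothesis Rel_total : forall A, measurable A -> exists E, Rel A E.

Let E m i := projT1 (cid (Rel_total (basis_measurable m i))).

Let RelE m i : Rel (basis m i) (E m i).
Proof. exact: (projT2 (cid (Rel_total (basis_measurable m i)))). Qed.

(** [E m i x] is read as the prescription that the image of [x] lie in [basis m i]. A good point has
    a prescription at every scale, and no two of them contradict each other. *)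
Let good x := (forall m, exists i, E m i x) /\
  forall m i m' i', E m i x -> E m' i' x -> basis m i `&` basis m' i' !=set0.

Let ae_good : {ae mu, forall x, good x}.
Proof.
have [Rm RC RU] := RelP.
have H1 m : {ae mu, forall x, exists i, E m i x}.
  have cov : \bigcup_i basis m i = setT.
    by apply/seteqP; split=> // x _; have [i ?] := basis_cover m x; exists i.
  have := RU _ _ (RelE m); rewrite cov => /Rm[_ mE].
  move=> TE; apply: filterS (null_equal_ae (mu := mu) mE _) => [x [i _ ?]|].
    by exists i.
  by rewrite probability_setC// -TE probability_setT subee.
have H2 m i m' i' : {ae mu, forall x, E m i x -> E m' i' x ->
    basis m i `&` basis m' i' !=set0}.
  have [bb|] := pselect (basis m i `&` basis m' i' !=set0); first exact: aeW.
  move=> /set0P/negP/negPn/eqP b0.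
  have := relI RelP (RelE m i) (RelE m' i').
  rewrite b0 => /Rm[_ mEE]; rewrite measure0 => E0.
  exists (E m i `&` E m' i'); split => // x /= H; apply: contrapT => EE; apply: H.
  by move=> ? ?; case: EE.
apply: filterS2 (ae_foralln H1) (ae_foralln (fun m => ae_foralln (fun i =>
  ae_foralln (fun m' => ae_foralln (H2 m i m'))))) => x h1 h2.
by split => // m i m' i'; exact: h2.
Qed.

(** Cells prescribed by the same [x] meet, so centres at scales [m] and [m'] are within
    [radius m + radius m'] of each other. They form a Cauchy sequence, and surjectivity of [phi]
    brings its limit back to [X]. *)
Let good_limit x : good x ->
  exists t, forall m i, E m i x -> ball (y i) (dbl m) (phi t).
Proof.
move=> [Ecov Emeet]; have [i_ Ei] := choice Ecov.
have near m i m' : E m i x ->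
    exists2 z, ball (y i) (radius m) z & ball z (radius m') (y (i_ m')).
  move=> /Emeet /(_ (Ei m'))[z [/basis_ball z1 /basis_ball z2]].
  by exists (phi z) => //; exact: ball_sym.
pose u m := y (i_ m).
have : cvg (u @ \oo).
  apply: cauchy_cvg; apply: cauchy_exP => e e0.
  have e2 : 0 < e / 2 by rewrite divr_gt0.
  have [m _ mP] := radius_small e2.
  exists (u m); exists m => // m' /= mm'.
  have [z z1 z2] := near m (i_ m) m' (Ei m).
  have := ball_triangle z1 z2; apply: le_ball.
  by rewrite [leRHS]splitr lerD// ltW//; apply: mP => /=.
move: (lim _) => l ul; have [psi _ psiK] := phi_bij.
exists (psi l) => m i Ex; rewrite psiK.
have r2 : 0 < radius m / 2 by rewrite divr_gt0.
have [m' [lm' rm']] : exists m', ball l (radius m / 2) (u m') /\ radius m' < radius m / 2.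
  have [k _ kP] := cvg_ball ul r2; have [k' _ k'P] := radius_small r2.
  exists (maxn k k'); split; [apply: kP|apply: k'P]; rewrite /= ?leq_maxl ?leq_maxr//.
have [z z1 z2] := near m i m' Ex.
have := ball_triangle (ball_triangle z1 z2) (ball_sym lm'); apply: le_ball.
by rewrite /dbl; lra.
Qed.

Lemma realize : exists2 T : X -> X, measure_preserving mu T &
  forall A F, Rel A F -> null_equal mu (T @^-1` A) F.
Proof.
have [Rm RC RU] := RelP.
have [N [mN N0 goodN]] := ae_good.
(* [T] is made constant on the null set [N] of bad points, so that it is measurable everywhere and
   not only off a null set. *)
have : forall x, exists t, (N x -> t = point) /\
    (~ N x -> forall m i, E m i x -> ball (y i) (dbl m) (phi t)).
  move=> x; have [xN|xN] := pselect (N x); first by exists point.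
  have [|t tP] := @good_limit x; first by apply: contrapT => /goodN.
  by exists t.
move=> /choice[T TP].
have Tcov x m : ~ N x -> exists i, E m i x.
  by move=> xN; have [+ _] : good x by apply: contrapT => /goodN.
pose G := [set B | measurable (T @^-1` B) /\
  exists2 F, Rel B F & null_equal mu (T @^-1` B) F].
have sG : sigma_closed G.
  split=> [A [mA [F AF TF]]|A GA].
    split; first by rewrite preimage_setC; exact: measurableC.
    by exists (~` F); [exact: RC|exact: null_equalC TF].
  have /choice[F FP] : forall n, exists F, Rel (A n) F /\ null_equal mu (T @^-1` A n) F.
    by move=> n; have [_ [F ? ?]] := GA n; exists F.
  rewrite /G/= preimage_bigcup; split; first by apply: bigcup_measurable => n _; case: (GA n).
  exists (\bigcup_n F n); first by apply: RU => n; case: (FP n).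
  by apply: null_equal_bigcup => n; case: (FP n).
have GM : forall B, measurable B -> G B.
  apply: basis_induction => // m i.
  have := @open_interior _ (ball (y i) (radius m)).
  rewrite /basis; move: (_^°) => U oU.
  (* The selection that rebuilds the preimage of [U] from [basis], taken from [E] instead: off [N]
     it is exactly the preimage under [T]. *)
  pose F := \bigcup_n select U E n.
  have UF : Rel (phi @^-1` U) F.
    rewrite preimage_open_select//; apply: RU => n; rewrite /select.
    by case: ifP => // _; exact: (rel0 RelP (RelE 0 0)%N).
  have TF x : ~ N x -> U (phi (T x)) <-> F x.
    move=> xN; apply: open_selectP => //; first by move=> k; exact: Tcov.
    exact: (TP x).2.
  have [_ mF _] := Rm _ _ UF.
  split; last first.
    by exists F => //; exists N; split => // x /= H; apply: contrapT => /TF.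
  have -> : T @^-1` (phi @^-1` U) =
      (F `\` N) `|` (N `&` (if `[< U (phi point) >] then setT else set0)).
    apply/seteqP; split=> x /=.
      have [xN|xN] := pselect (N x); last by move=> /TF; left; split => //; tauto.
      by rewrite (TP x).1// => UT; right; rewrite asboolT.
    move=> [[Fx xN]|[xN]]; first exact/TF.
    by rewrite (TP x).1//; case: asboolP.
  apply: measurableU; first exact: measurableD.
  by apply: measurableI => //; case: ifP.
have TRel A F : Rel A F -> null_equal mu (T @^-1` A) F.
  move=> AF; have [mA _ _] := Rm _ _ AF; have [_ [F' AF' TF']] := GM _ mA.
  exact: null_equal_trans TF' (rel_unique RelP AF' AF).
exists T => //; split=> [_ B mB|A mA]; first by rewrite setTI; case: (GM _ mB).
have [mTA [F AF TF]] := GM _ mA; have [_ mF ->] := Rm _ _ AF.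
exact: null_equal_measure.
Qed.

End realize.
End polish_basis.

Section standard_borel_theory.
Context d (X : measurableType d) (R : realType).
Hypothesis sX : standard_borel X R.

Lemma standard_borel_generators : exists A : (set X)^nat,
  [/\ forall n, measurable (A n),
      forall G, sigma_closed G -> (forall n, G (A n)) ->
        forall B, measurable B -> G B &
      forall x x', (forall n, A n x <-> A n x') -> x = x'].
Proof.
have [Y [phi [Yp phib mE]]] := sX.
exists (fun n => basis phi Yp (decode n).1 (decode n).2); split.
- by move=> n; exact: (basis_measurable _ mE).
- move=> G sG Gb; apply: (basis_induction (Ypolish := Yp) mE sG) => m i.
  by have := Gb (pickle (m, i)); rewrite decodeK.
- move=> x x' xx'; apply: (basis_separates (Ypolish := Yp) phib) => m i.
  by have := xx' (pickle (m, i)); rewrite decodeK.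
Qed.

Variable mu : probability X R.

Lemma realization Rel : measure_relation mu Rel ->
    (forall A, measurable A -> exists E, Rel A E) ->
  exists2 T : X -> X, measure_preserving mu T &
    forall A F, Rel A F -> null_equal mu (T @^-1` A) F.
Proof. by have [Y [phi [Yp phib mE]]] := sX; exact: (realize Yp phib mE). Qed.

(** A countable separating family is enough to test points, so the exceptional null sets add up to a
    null set. *)
Lemma ae_id (T : X -> X) :
  (forall A, measurable A -> null_equal mu (T @^-1` A) A) ->
  {ae mu, forall x, T x = x}.
Proof.
move=> TA; have [A [mA _ sep]] := standard_borel_generators.
by apply: filterS (ae_foralln (fun n => TA _ (mA n))) => x /= Tx; exact: sep.
Qed.

(** The converse relation is realised by some [S]. Both compositions fix every measurable set up to
    a null set, hence almost every point. *)
Lemma realization_invertible Rel : measure_relation mu Rel ->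
    (forall A, measurable A -> exists E, Rel A E) ->
    (forall E, measurable E -> exists A, Rel A E) ->
  exists T : X -> X, [/\ measure_preserving mu T, essentially_invertible mu T &
    forall A F, Rel A F -> null_equal mu (T @^-1` A) F].
Proof.
move=> RelP tot1 tot2; have [Rm _ _] := RelP.
have [T Tmp TP] := realization RelP tot1.
have [S Smp SP] := realization (measure_relation_sym RelP) tot2.
exists T; split => //; exists S => //.
have ST : {ae mu, forall x, S (T x) = x}.
  apply: (@ae_id (S \o T)) => A /tot2[B BA]; have [mB mA _] := Rm _ _ BA.
  have H := mp_ae Tmp (SP _ _ BA).
  exact: null_equal_trans H (TP _ _ BA).
have TS : {ae mu, forall x, T (S x) = x}.
  apply: (@ae_id (T \o S)) => A /tot1[B AB].
  have H := mp_ae Smp (TP _ _ AB).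
  exact: null_equal_trans H (SP _ _ AB).
by apply: filterS2 ST TS => x ? ?; split.
Qed.

End standard_borel_theory.

(** * Isomorphisms between sets of equal measure *)

Section coding.
Context d (X : measurableType d) (R : realType).
Hypothesis sX : standard_borel X R.

(* [ternary A 0 x] is the real number whose ternary digits are [2] at the [n] with
   [A n x] and [0] elsewhere; the [A n x] are recovered from it by iterating
   the shift [t |-> 3 t - 2 [1/2 < t]]. *)
Let partial (A : (set X)^nat) m x n : R :=
  \sum_(k < n) 2 / 3 ^+ k.+1 * \1_(A (m + k)%N) x.

Let ternary A m x : R := limn (partial A m x).

Let indic01 (A : set X) x : 0 <= (\1_A x : R) <= 1.
Proof. by rewrite indicE; case: (x \in A); rewrite ?lexx ?ler01. Qed.

Let partialS A m x n :
  partial A m x n.+1 = (2 * \1_(A m) x + partial A m.+1 x n) / 3.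
Proof.
rewrite /partial big_ord_recl/= addn0 expr1 [RHS]mulrDl; congr (_ + _).
  by rewrite mulrAC.
rewrite mulr_suml; apply: eq_bigr => k _; rewrite addSnnS exprSr invfM.
by rewrite /bump /= add1n !mulrA mulrAC.
Qed.

Let partial01 A m x n : 0 <= partial A m x n <= 1.
Proof.
elim: n m => [|n IHn] m; first by rewrite /partial big_ord0 lexx ler01.
have := IHn m.+1; have := indic01 (A m) x; rewrite partialS => ? ?; lra.
Qed.

Let partial_cvg A m x : partial A m x @ \oo --> ternary A m x.
Proof.
apply: nondecreasing_is_cvgn.
  apply/nondecreasing_seqP => n; rewrite /partial big_ord_recr/= lerDl.
  by rewrite mulr_ge0 ?divr_ge0 ?exprn_ge0//; case/andP: (indic01 (A (m + n)%N) x).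
by exists 1 => _ [n _ <-]; case/andP: (partial01 A m x n).
Qed.

Let ternary01 A m x : 0 <= ternary A m x <= 1.
Proof.
apply/andP; split.
- apply: (cvgr_to_ge (partial_cvg (A := A) (m := m) (x := x))).
  by apply: nearW => n; case/andP: (partial01 A m x n).
- apply: (cvgr_to_le (partial_cvg (A := A) (m := m) (x := x))).
  by apply: nearW => n; case/andP: (partial01 A m x n).
Qed.

Let ternaryS A m x : ternary A m x = (2 * \1_(A m) x + ternary A m.+1 x) / 3.
Proof.
have H1 : (partial A m x n.+1 @[n --> \oo]) --> ternary A m x.
  by rewrite (cvg_shiftS (partial A m x)); exact: partial_cvg.
have H2 : ((2 * \1_(A m) x + partial A m.+1 x n) / 3 @[n --> \oo]) -->
    (2 * \1_(A m) x + ternary A m.+1 x) / 3.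
  apply: cvgM; last exact: cvg_cst.
  by apply: cvgD; [exact: cvg_cst|exact: partial_cvg].
have E : (fun n => partial A m x n.+1) =
    (fun n => (2 * \1_(A m) x + partial A m.+1 x n) / 3).
  by apply/funext => n; rewrite partialS.
by rewrite E in H1; exact: (cvg_unique (@norm_hausdorff _ _) H1 H2).
Qed.

Let shift (t : R) := 3 * t - 2 * \1_(`]1 / 2, +oo[%classic) t.

(** A leading digit 0 leaves at most 1/3 and a leading digit 2 gives at least 2/3. Restricting to
    these digits removes the ambiguity of expansions, and 1/2 tells them apart. *)
Let ternary_gt A m x : (1 / 2 < ternary A m x) = (x \in A m).
Proof.
rewrite ternaryS indicE; have := ternary01 A m.+1 x.
by case: (x \in A m) => /=; [move=> ?; apply/idP|move=> ?; apply/negbTE]; lra.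
Qed.

Let ternary_shift A m x : ternary A m.+1 x = shift (ternary A m x).
Proof.
rewrite /shift indicE mem_setE/= in_itv/= andbT ternary_gt.
by rewrite [in RHS]ternaryS indicE; lra.
Qed.

Let shift_measurable n : measurable_fun setT (iter n shift).
Proof.
elim: n => [|n IHn]; first exact: measurable_id.
apply: (measurableT_comp _ IHn).
by apply: measurable_funB; apply: measurable_funM.
Qed.

(** Preimages of Borel sets under [c] are stable under complements and countable unions, and each
    generator is one of them because its digit is a Borel function of the code. *)
Lemma real_coding : exists c : X -> R,
  [/\ measurable_fun setT c, forall x, 0 <= c x <= 1 &
      forall B, measurable B -> exists2 C : set R, measurable C & B = c @^-1` C].
Proof.
have [A [mA Aind _]] := standard_borel_generators sX.
exists (ternary A 0); split => //.
  apply: (@measurable_fun_cvg _ _ _ _ (fun n x => partial A 0 x n)) => [m|x _].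
    by apply: measurable_sum => k; apply: measurable_funM.
  exact: partial_cvg.
apply: Aind => [|n].
  split=> [B [C mC ->]|B BC]; first by exists (~` C) => //; exact: measurableC.
  have /choice[C CP] n : exists C : set R, measurable C /\ B n = ternary A 0 @^-1` C.
    by have [C ? ?] := BC n; exists C.
  exists (\bigcup_n C n); first by apply: bigcup_measurable => n _; case: (CP n).
  by rewrite preimage_bigcup; apply: eq_bigcupr => n _; case: (CP n).
exists (iter n shift @^-1` `]1 / 2, +oo[%classic).
  by rewrite -[X in measurable X]setTI; exact: shift_measurable.
apply/seteqP; split=> x.
- rewrite /= in_itv/= andbT.
  have -> : iter n shift (ternary A 0 x) = ternary A n x.
    by elim: n => //= n ->; rewrite ternary_shift.
  by rewrite ternary_gt inE.
- rewrite /= in_itv/= andbT.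
  have -> : iter n shift (ternary A 0 x) = ternary A n x.
    by elim: n => //= n ->; rewrite ternary_shift.
  by rewrite ternary_gt inE.
Qed.

End coding.

Section real_probability.
Context d (X : measurableType d) (R : realType) (mu : probability X R).

Definition pr (A : set X) : R := fine (mu A).

Lemma prE A : measurable A -> (pr A)%:E = mu A.
Proof. by move=> mA; rewrite fineK// fin_num_measure. Qed.

Lemma pr_ge0 A : 0 <= pr A. Proof. exact: fine_ge0. Qed.

Lemma pr0 : pr set0 = 0. Proof. by rewrite /pr measure0. Qed.

Lemma pr_inj A B : measurable A -> measurable B -> pr A = pr B -> mu A = mu B.
Proof. by move=> mA mB AB; rewrite -!prE// AB. Qed.

Lemma prS A B : measurable A -> measurable B -> A `<=` B -> pr A <= pr B.
Proof.
by move=> mA mB AB; rewrite -lee_fin !prE// le_measure// inE.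
Qed.

Lemma prU A B : measurable A -> measurable B -> A `&` B = set0 ->
  pr (A `|` B) = pr A + pr B.
Proof.
move=> mA mB AB; apply: EFin_inj; rewrite EFinD !prE// ?measureU//.
exact: measurableU.
Qed.

Lemma prD A B : measurable A -> measurable B -> B `<=` A ->
  pr (A `\` B) = pr A - pr B.
Proof.
move=> mA mB BA; rewrite -[in RHS](setDUK BA) prU//; last by rewrite setDIK.
- by rewrite addrC addKr.
- exact: measurableD.
Qed.

Lemma pr_null_equal A B : measurable A -> measurable B -> null_equal mu A B ->
  pr A = pr B.
Proof. by move=> mA mB AB; rewrite /pr (null_equal_measure _ _ AB). Qed.

Lemma measurable_label (I : finType) (f : X -> I) (P : pred I) :
  (forall i, measurable (f @^-1` [set i])) -> measurable [set x | P (f x)].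
Proof.
move=> mf; have -> : [set x | P (f x)] = \bigcup_(i in [set i | P i]) f @^-1` [set i].
  by apply/seteqP; split=> [x fx|x [i iP /= ->]]; [exists (f x)|].
by apply: fin_bigcup_measurable => //; exact: finite_finset.
Qed.

Definition additive_set_fun (nu : set X -> R) := forall A B,
  measurable A -> measurable B -> A `&` B = set0 -> nu (A `|` B) = nu A + nu B.

Lemma additive_set_fun_sum (nu : set X -> R) (I : finType) (f : X -> I) (P : pred I) :
  additive_set_fun nu -> (forall i, measurable (f @^-1` [set i])) ->
  nu [set x | P (f x)] = \sum_(i | P i) nu (f @^-1` [set i]).
Proof.
move=> nuU mf; have nu0 : nu set0 = 0.
  have := nuU set0 set0 measurable0 measurable0 (setI0 _).
  by rewrite setU0 => /eqP; rewrite -subr_eq0 opprD addNKr oppr_eq0 => /eqP.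
have -> : [set x | P (f x)] = [set x | P (f x) && (f x \in index_enum I)].
  by apply/seteqP; split=> x /=; rewrite mem_index_enum andbT.
elim: (index_enum I) (index_enum_uniq I) => [_|i s IHs /= /andP[nis us]].
  by rewrite big_nil -[RHS]nu0; congr nu; apply/seteqP; split => x //=; rewrite andbF.
have mS : measurable [set x | P (f x) && (f x \in s)].
  exact: (measurable_label (fun i => P i && (i \in s))).
rewrite big_cons; case: ifPn => Pi; last first.
  rewrite -IHs//; congr nu; apply/seteqP; split=> x /=; rewrite inE.
    by move=> /andP[Pfx /orP[/eqP fxi|->]]; [rewrite -fxi Pfx in Pi|rewrite Pfx].
  by move=> /andP[-> ->]; rewrite orbT.
rewrite -IHs// -nuU//.
  congr nu; apply/seteqP; split=> x /=; rewrite inE.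
    by move=> /andP[Pfx /orP[/eqP|->]]; [left|right; rewrite Pfx].
  by move=> [->|/andP[-> ->]]; rewrite ?Pi ?eqxx ?orbT.
by apply/seteqP; split=> x //= [->]; rewrite (negbTE nis) andbF.
Qed.

End real_probability.

(** * Uniform distribution of ranks and matching of labelled pieces *)

Section rank.
Context d (X : measurableType d) (R : realType) (mu : probability X R).
Local Notation pr := (pr mu).
Variable c : X -> R.
Hypotheses (mc : measurable_fun setT c) (c01 : forall x, 0 <= c x <= 1).
Hypothesis cgen : forall B, measurable B ->
  exists2 C : set R, measurable C & B = c @^-1` C.
Hypothesis catom : forall t, mu (c @^-1` [set t]) = 0%E.

Let below t : set X := [set x | c x <= t].

Let mcpre C : measurable C -> measurable (c @^-1` C).
Proof. by move=> mC; rewrite -[X in measurable X]setTI; exact: mc. Qed.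

Let below_preimage t : below t = c @^-1` `]-oo, t]%classic.
Proof. by apply/seteqP; split=> x; rewrite /below/= in_itv. Qed.

Let mbelow t : measurable (below t).
Proof. by rewrite below_preimage; exact: mcpre. Qed.

Let mcap A t : measurable A -> measurable (A `&` [set x | c x <= t]).
Proof. by move=> mA; apply: measurableI => //; exact: mbelow. Qed.

Lemma below_induction G : sigma_closed G -> (forall t, G [set x | c x <= t]) ->
  forall B, measurable B -> G B.
Proof.
move=> sG Gb B /cgen[C mC ->].
have : <<s @RGenOInfty.G R >> C by rewrite -[<<s _ >>]RGenOInfty.measurableE.
move=> GC; apply: (@smallest_sub _ _ _ [set C | G (c @^-1` C)] _ _ C GC) => [|A [t ->]]/=.
  split=> [|A GA|A GA] /=.
  - by rewrite preimage_set0; have [] := sigma_closed_algebra (Gb 0) sG.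
  - by rewrite setTD -preimage_setC; exact: sG.1.
  - by rewrite preimage_bigcup; exact: sG.2.
have -> : c @^-1` `]t, +oo[%classic = ~` below t.
  by rewrite below_preimage preimage_setC setCitvl.
by apply: sG.1; exact: Gb.
Qed.

(** The unnormalised distribution function of [c] on [A]. Composing it with [c], as [rank] does, is
    the probability integral transform. *)
Definition cumulative A t : R := pr (A `&` [set x | c x <= t]).

Definition rank A x : R := cumulative A (c x).

Lemma cumulative_homo A : measurable A -> {homo cumulative A : s t / s <= t}.
Proof.
move=> mA s t st; apply: prS; [exact: mcap|exact: mcap|].
by apply: setIS => x /le_trans; exact.
Qed.

Lemma cumulative_le A t : measurable A -> cumulative A t <= pr A.
Proof. by move=> mA; apply: prS => //; exact: mcap. Qed.

(** [t] is the largest level whose cumulative measure is at most [s]. Continuity from below together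
    with the null fibre over [t] shows that the supremum is itself such a level; continuity from
    above excludes a value smaller than [s]. *)
Lemma cumulative_attains A (s : R) : measurable A -> 0 <= s < pr A ->
  exists t, cumulative A t = s /\ forall u, (cumulative A u <= s) = (u <= t).
Proof.
move=> mA /andP[s0 sA]; pose S := [set t | cumulative A t <= s].
(* As [c] takes values between 0 and 1, a level above 1 counts all of [A], contrary to [s < pr A],
   and the level -1 used next counts nothing. *)
have Slt1 u : S u -> u <= 1.
  move=> Su; rewrite leNgt; apply/negP => u1; move: Su; rewrite /S/= leNgt => /negP; apply.
  suff -> : cumulative A u = pr A by [].
  rewrite /cumulative; congr pr; apply/setIidPl => x _ /=.
  by have /andP[_ /le_trans] := c01 x; apply; exact: ltW.
have SN1 : S (- 1).
  rewrite /S/= /cumulative (_ : _ `&` _ = set0) ?pr0//.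
  apply/seteqP; split=> x //= [_]; have /andP[x0 _] := c01 x.
  by move=> /(le_trans x0); rewrite oppr_ge0 ler10.
have hS : has_sup S by split; [exists (- 1)|exists 1 => u; exact: Slt1].
have down u : S u -> forall v, v <= u -> S v.
  by move=> Su v vu; rewrite /S/=; apply: le_trans Su; exact: cumulative_homo.
pose t := sup S.
have St : S t.
  pose F n : set X := A `&` below (t - n.+1%:R^-1).
  have mF n : measurable (F n) by exact: mcap.
  have FU : \bigcup_n F n = A `&` [set x | c x < t].
    apply/seteqP; split=> [x [n _ [Ax xt]]|x [Ax xt]].
      split => //=; apply: le_lt_trans xt _.
      by rewrite ltrBlDr ltrDl invr_gt0.
    have tx : 0 < t - c x by rewrite subr_gt0.
    have [n _ /(_ n (leqnn _)) /= nP] := near_infty_natSinv_lt (PosNum tx).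
    by exists n => //; split => //; rewrite /below/= lerBrDr -lerBrDl ltW.
  have mFU : measurable (\bigcup_n F n) by exact: bigcup_measurable.
  have Fmono : {homo F : n m / (n <= m)%N >-> (n <= m)%O}.
    move=> n m nm; apply/subsetPset; apply: setIS => x /le_trans; apply.
    by rewrite lerD2l lerN2 lef_pV2 ?posrE// ler_nat.
  have /cvge_to_le le_s := nondecreasing_cvg_mu (mu := mu) mF mFU Fmono.
  have : (mu (A `&` [set x | (c x < t)%R]) <= s%:E)%E.
    rewrite -FU; apply: le_s; apply: nearW => n /=.
    rewrite -prE// lee_fin.
    have [u Su ut] := @sup_adherent _ S (n.+1%:R^-1) ltac:(by rewrite invr_gt0) hS.
    by apply: (down u) => //; exact: ltW.
  have -> : S t = (cumulative A t <= s) :> Prop by [].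
  rewrite -lee_fin prE; last exact: mcap.
  move=> H; apply: le_trans H.
  have mlt : measurable [set x | c x < t].
    rewrite (_ : [set x | _] = c @^-1` `]-oo, t[%classic); first exact: mcpre.
    by apply/seteqP; split=> x /=; rewrite in_itv.
  have meq : measurable (c @^-1` [set t]) by exact: mcpre.
  apply: (@le_trans _ _ (mu (A `&` [set x | (c x < t)%R]) + mu (c @^-1` [set t]))%E).
    apply: le_trans (measureU2 _ _ _) => //; last exact: measurableI.
    apply: le_measure; rewrite ?inE; [exact: mcap| |].
      by apply: measurableU => //; exact: measurableI.
    move=> x [Ax]; rewrite /= le_eqVlt => /orP[/eqP|]; [by right|by left].
  by rewrite catom adde0.
have Su_le u : S u -> u <= t by move=> Su; apply: ub_le_sup => //; exact: hS.2.
exists t; split; last first.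
  by move=> u; apply/idP/idP; [exact: Su_le|exact: down].
apply/eqP; rewrite eq_le; apply/andP; split; first exact: St.
pose F n : set X := A `&` below (t + n.+1%:R^-1).
have mF n : measurable (F n) by exact: mcap.
have FI : \bigcap_n F n = A `&` below t.
  apply/seteqP; split=> [x Fx|x [Ax xt] n _]; last first.
    split => //; apply: le_trans xt _.
    by rewrite lerDl invr_ge0.
  split; first by have [] := Fx 0%N I.
  rewrite /below/= leNgt; apply/negP => tx.
  have xt : 0 < c x - t by rewrite subr_gt0.
  have [n _ /(_ n (leqnn _)) /= nP] := near_infty_natSinv_lt (PosNum xt).
  by have [_] := Fx n I; rewrite /below/= leNgt -ltrBrDl nP.
have mFI : measurable (\bigcap_n F n) by exact: bigcapT_measurable.
have F0 : (mu (F 0%N) < +oo)%E by rewrite -prE// ltry.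
have Fmono : nonincreasing_seq F.
  move=> n m nm; apply/subsetPset; apply: setIS => x /le_trans; apply.
  by rewrite lerD2l lef_pV2 ?posrE// ler_nat.
have /cvge_to_ge ge_s := nonincreasing_cvg_mu (mu := mu) F0 mF mFI Fmono.
rewrite -lee_fin prE; last exact: mcap.
rewrite -[A `&` _]FI; apply: ge_s; apply: nearW => n /=.
rewrite -prE// lee_fin leNgt; apply/negP => /ltW Sn.
by have := Su_le _ Sn; rewrite gerDl leNgt invr_gt0 ltr0Sn.
Qed.

Lemma measurable_rank A : measurable A -> measurable_fun setT (rank A).
Proof.
move=> mA; apply: (measurableT_comp _ mc).
by apply: nondecreasing_measurable => //; exact: cumulative_homo.
Qed.

Let mrank_le A (s : R) : measurable A -> measurable [set x | rank A x <= s].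
Proof.
move=> mA; rewrite (_ : [set x | _] = rank A @^-1` `]-oo, s]%classic); last first.
  by apply/seteqP; split=> x /=; rewrite in_itv.
by rewrite -[X in measurable X]setTI; exact: measurable_rank.
Qed.

(* The rank in [A] is thus uniformly distributed on the interval from 0 to [pr A]. *)
Lemma rank_law A (s : R) : measurable A ->
  pr (A `&` [set x | rank A x <= s]) = Num.max 0 (Num.min s (pr A)).
Proof.
move=> mA; have [s0|s0] := ltP s 0.
  rewrite (_ : _ `&` _ = set0).
    by rewrite pr0 max_l// ge_min (ltW s0).
  apply/seteqP; split=> x //= [_].
  by rewrite leNgt (lt_le_trans s0)// pr_ge0.
have [sA|sA] := ltP s (pr A); last first.
  rewrite max_r ?pr_ge0//; congr pr; apply/setIidPl => x _ /=.
  by apply: le_trans sA; exact: cumulative_le.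
have [|t [ts tP]] := @cumulative_attains A s mA; first by rewrite s0.
rewrite max_r// -[RHS]ts; congr pr; congr (_ `&` _).
by apply/seteqP; split=> x /=; rewrite /rank tP.
Qed.

(** By [rank_law] the mass of a ray depends on the measure of the set alone; rays are stable under
    intersection, and Dynkin induction extends the equality to Borel sets. *)
Lemma rank_equidistributed A A' C : measurable A -> measurable A' ->
  mu A = mu A' -> measurable C ->
  mu (A `&` rank A @^-1` C) = mu (A' `&` rank A' @^-1` C).
Proof.
move=> mA mA' AA' mC.
have mpre D B : measurable D -> measurable B -> measurable (rank D @^-1` B).
  by move=> mD mB; rewrite -[X in measurable X]setTI; exact: measurable_rank.
have mr D B : measurable D -> measurable B -> measurable (D `&` rank D @^-1` B).
  by move=> mD mB; apply: measurableI => //; exact: mpre.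
have prAA' : pr A = pr A' by congr fine.
have prC D B : measurable D -> measurable B ->
    pr (D `&` rank D @^-1` (~` B)) = pr D - pr (D `&` rank D @^-1` B).
  move=> mD mB; rewrite -prD//; last exact: mr.
  by rewrite preimage_setC setDIr setDv set0U setDE.
apply: pr_inj; [exact: mr|exact: mr|].
pose P := [set C | pr (A `&` rank A @^-1` C) = pr (A' `&` rank A' @^-1` C)].
have GC : <<s @RGenOInfty.G R >> C by rewrite -[<<s _ >>]RGenOInfty.measurableE.
apply: (@dynkin_induction _ _ (@RGenOInfty.G R) P _ _ _ _ _ _ C GC).
- exact: RGenOInfty.measurableE.
- move=> _ _ [s ->] [t ->]; exists (Num.max s t); apply/seteqP.
  by split=> x /=; rewrite !in_itv/= !andbT gt_max => /andP.
- by rewrite /P/= !preimage_setT !setIT.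
- move=> _ [s ->]; rewrite /P/=; have -> : `]s, +oo[%classic = ~` `]-oo, s]%classic :> set R.
    by rewrite setCitvl.
  rewrite !prC// prAA'; congr (_ - _).
  have D B : measurable B -> pr (B `&` rank B @^-1` `]-oo, s]%classic) =
      Num.max 0 (Num.min s (pr B)).
    move=> mB; rewrite -(rank_law s mB); congr (pr (B `&` _)).
  by rewrite !D// prAA'.
- by move=> B mB; rewrite /P/= => PB; rewrite !prC// prAA' PB.
- move=> F mF tF PF; rewrite /P/=.
  have S B : measurable B ->
      mu (B `&` rank B @^-1` (\bigcup_k F k)) = (\sum_(k <oo) mu (B `&` rank B @^-1` F k))%E.
    move=> mB; rewrite preimage_bigcup setI_bigcupr measure_semi_bigcup//.
    - by move=> k; exact: mr.
    - apply/trivIsetP => i j _ _ ij; rewrite setIACA setIid -preimage_setI.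
      by move/trivIsetP : tF => ->//; rewrite preimage_set0 setI0.
    - by apply: bigcup_measurable => k _; exact: mr.
  congr fine; rewrite !S//; apply: eq_eseriesr => k _.
  by apply: pr_inj; [exact: mr|exact: mr|exact: PF].
Qed.

Lemma subset_of_measure A (s : R) : measurable A -> 0 <= s <= pr A ->
  exists B, [/\ measurable B, B `<=` A & pr B = s].
Proof.
move=> mA /andP[s0 sA]; exists (A `&` [set x | rank A x <= s]); split.
- by apply: measurableI => //; exact: mrank_le.
- exact: subIsetl.
- by rewrite rank_law// min_l// max_r.
Qed.

(** Pieces are cut off one label at a time. Encoding them by a function [e] makes them disjoint from
    the start; the sum over [j == i] accounts for repetitions in [s]. *)
Lemma labelling_of_measures (I : eqType) (i0 : I) (s : seq I) (p : I -> R) A :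
  (forall i, 0 <= p i) -> measurable A -> pr A = \sum_(i <- s) p i ->
  exists e : X -> I, (forall i, measurable (e @^-1` [set i])) /\
    forall i, pr (A `&` e @^-1` [set i]) = \sum_(j <- s | j == i) p j.
Proof.
move=> p0; elim: s A => [|j s IHs] A mA.
  rewrite big_nil => A0; exists (fun=> i0); split=> i.
    by rewrite preimage_cst; case: ifP.
  apply/eqP; rewrite big_nil eq_le pr_ge0 -A0 prS//.
  by rewrite preimage_cst; case: ifP => // _; [rewrite setIT|rewrite setI0].
rewrite big_cons => As.
have [|B [mB BA Bj]] := @subset_of_measure A (p j) mA.
  by rewrite p0 As lerDl sumr_ge0.
have [||e [me eE]] := IHs (A `\` B); first exact: measurableD.
  by rewrite prD// As Bj addrC addKr.
exists (fun x => if `[< B x >] then j else e x).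
have preE i : (fun x => if `[< B x >] then j else e x) @^-1` [set i] =
    (if j == i then B else set0) `|` (e @^-1` [set i] `\` B).
  apply/seteqP; split=> x /=.
    case: asboolP => Bx; first by move=> <-; rewrite eqxx; left.
    by right.
  by case: eqP => [ji|_] [Bx|[ex Bx]] //; [rewrite asboolT|rewrite asboolF|rewrite asboolF].
split=> i; rewrite preE.
  by apply: measurableU; [case: ifP|exact: measurableD].
rewrite big_cons; case: eqP => [ji|_].
  have -> : A `&` (B `|` e @^-1` [set i] `\` B) = B `|` ((A `\` B) `&` e @^-1` [set i]).
    by apply/seteqP; split=> x; have := BA x; rewrite /setD/=; tauto.
  rewrite prU//; [|by apply: measurableI => //; exact: measurableD|].
    by rewrite Bj eE.
  by apply/seteqP; split=> x //=; rewrite /setD/=; tauto.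
rewrite set0U -eE; congr pr; apply/seteqP.
by split=> x /=; rewrite /setD/=; tauto.
Qed.

Section labels.
Variables (J : finType).

Definition rank_in (l : X -> J) x := rank (l @^-1` [set l x]) x.

(** A set is described by Borel sets of ranks, one for each label. Reading the same [C] through
    another labelling gives the corresponding set there, which matches points of equal label and
    rank without inverting [rank]. *)
Let code (l : X -> J) (C : J -> set R) : set X := [set x | C (l x) (rank_in l x)].

Let codeE (l : X -> J) (C : J -> set R) : code l C =
  \bigcup_(j in setT) (l @^-1` [set j] `&` rank (l @^-1` [set j]) @^-1` C j).
Proof.
apply/seteqP; split=> [x Cx|x [j _ /= [<-]//]].
by exists (l x).
Qed.

Let code_measurable_piece (l : X -> J) (C : J -> set R) j :
  (forall j, measurable (l @^-1` [set j])) ->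
  (forall j, measurable (C j)) ->
  measurable (l @^-1` [set j] `&` rank (l @^-1` [set j]) @^-1` C j).
Proof.
move=> ml mC; apply: measurableI => //.
by rewrite -[X in measurable X]setTI; exact: measurable_rank.
Qed.

Let code_measurable (l : X -> J) (C : J -> set R) : (forall j, measurable (l @^-1` [set j])) ->
  (forall j, measurable (C j)) -> measurable (code l C).
Proof.
move=> ml mC; rewrite codeE; apply: fin_bigcup_measurable; first exact: finite_finset.
by move=> j _; exact: code_measurable_piece.
Qed.

Let code_measure (l : X -> J) (C : J -> set R) : (forall j, measurable (l @^-1` [set j])) ->
  (forall j, measurable (C j)) ->
  mu (code l C) =
  (\sum_(j \in setT) mu (l @^-1` [set j] `&` rank (l @^-1` [set j]) @^-1` C j))%E.
Proof.
move=> ml mC; rewrite codeE measure_fin_bigcup//; first exact: finite_finset.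
- by apply/trivIsetP => i j _ _ /eqP ij; apply/seteqP; split=> x //= [[-> _] []].
- by move=> j _; exact: code_measurable_piece.
Qed.

(** It suffices to code initial segments. In the piece labelled [j], [c x <= t] bounds the rank by
    the cumulative measure at [t]. The converse can fail where the cumulative function is flat, but
    by [rank_law] the two sets have the same measure. *)
Let code_total (l : X -> J) : (forall j, measurable (l @^-1` [set j])) ->
  forall A, measurable A ->
  exists C : J -> set R, (forall j, measurable (C j)) /\ null_equal mu A (code l C).
Proof.
move=> ml; apply: below_induction.
  split=> [A [C [mC AC]]|A AC].
    exists (fun j => ~` C j); split; first by move=> j; exact: measurableC.
    exact: null_equalC AC.
  have [C CP] := choice AC.
  exists (fun j => \bigcup_n C n j); split=> [j|].
    by apply: bigcup_measurable => n _; exact: (CP n).1.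
  apply: filterS (null_equal_bigcup (fun n => (CP n).2)) => x.
  by move=> ->; split=> -[n _ Cn]; exists n.
move=> t; exists (fun j => `]-oo, cumulative (l @^-1` [set j]) t]%classic).
split=> // .
pose D j := l @^-1` [set j] `&`
  [set x | rank (l @^-1` [set j]) x <= cumulative (l @^-1` [set j]) t].
have mD j : measurable (D j) by apply: measurableI => //; exact: mrank_le.
have DN j : {ae mu, forall x, D j x -> c x <= t}.
  have DB : l @^-1` [set j] `&` [set x | c x <= t] `<=` D j.
    by move=> x [lx xt]; split => //; exact: cumulative_homo.
  exists (D j `\` (l @^-1` [set j] `&` [set x | c x <= t])); split.
  - by apply: measurableD => //; exact: mcap.
  - rewrite -prE; last by apply: measurableD => //; exact: mcap.
    rewrite prD//; last exact: mcap.
    rewrite rank_law// min_l ?cumulative_le// max_r ?pr_ge0//.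
    by rewrite subrr.
  - by move=> x /= /not_implyP[Dx xt]; split => // -[].
have H : {ae mu, forall x, forall j, D j x -> c x <= t} by exact: filter_forall.
apply: filterS H => x Dx; split=> /= [xt|].
  by rewrite /code/= in_itv/=; exact: cumulative_homo.
by rewrite /code/= in_itv/= => xr; apply: (Dx (l x)); split.
Qed.

Hypothesis sX : standard_borel X R.

Lemma realize_labels (d' e : X -> J) :
  (forall j, measurable (d' @^-1` [set j])) ->
  (forall j, measurable (e @^-1` [set j])) ->
  (forall j, mu (d' @^-1` [set j]) = mu (e @^-1` [set j])) ->
  exists T : X -> X, [/\ measure_preserving mu T, essentially_invertible mu T &
    {ae mu, forall x, d' (T x) = e x}].
Proof.
move=> md me de.
(* Related sets have one common description [C], read through [d'] for [A] and through [e] for [E].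
   Equality of measures is [rank_equidistributed], piece by piece. *)
pose Rel A E := exists C : J -> set R, [/\ forall j, measurable (C j),
  measurable A /\ measurable E, null_equal mu A (code d' C) &
  null_equal mu E (code e C)].
have RelP : measure_relation mu Rel.
  split=> [A E [C [mC [mA mE] AC EC]]|A E [C [mC [mA mE] AC EC]]|A E /choice[C CP]].
  - split=> //; rewrite (null_equal_measure mA _ AC) ?(null_equal_measure mE _ EC);
      try exact: code_measurable.
    rewrite !code_measure//; apply: eq_fsbigr => j _.
    exact: rank_equidistributed.
  - exists (fun j => ~` C j); split=> //.
    + by move=> j; exact: measurableC.
    + by split; exact: measurableC.
    + exact: null_equalC AC.
    + exact: null_equalC EC.
  - exists (fun j => \bigcup_n C n j); split=> [j|||].
    + by apply: bigcup_measurable => n _; case: (CP n).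
    + by split; apply: bigcup_measurable => n _; case: (CP n) => _ [].
    + have H n : null_equal mu (A n) (code d' (C n)) by case: (CP n).
      apply: filterS (null_equal_bigcup H) => x.
      by move=> ->; split=> -[n _ Cn]; exists n.
    + have H n : null_equal mu (E n) (code e (C n)) by case: (CP n).
      apply: filterS (null_equal_bigcup H) => x.
      by move=> ->; split=> -[n _ Cn]; exists n.
have [||T [Tmp Tinv TP]] := realization_invertible sX RelP.
- move=> A mA; have [C [mC AC]] := code_total md mA.
  exists (code e C), C; split=> //; last exact: null_equal_refl.
  by split=> //; exact: code_measurable.
- move=> E mE; have [C [mC EC]] := code_total me mE.
  exists (code d' C), C; split=> //; last exact: null_equal_refl.
  by split=> //; exact: code_measurable.
exists T; split=> //.
have TJ j : null_equal mu (T @^-1` (d' @^-1` [set j])) (e @^-1` [set j]).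
  (* The piece labelled [j] is coded, in both labellings, by all ranks for [j] and none for the
     other labels. *)
  apply: TP; exists (fun i => if i == j then setT else set0); split=> //.
  - by move=> i; case: ifP.
  - by apply: aeW => x; rewrite /code/=; case: eqP.
  - by apply: aeW => x; rewrite /code/=; case: eqP.
have H : {ae mu, forall x, forall j, d' (T x) = j <-> e x = j}.
  exact: filter_forall.
apply: filterS H => x Tx.
by apply/(Tx (e x)).
Qed.

End labels.
End rank.

(** * Couplings *)

Section coupling.
Context d (X : measurableType d) (R : realType) (mu : probability X R).
Local Notation pr := (pr mu).

(* Finite additivity is enough: the marginals dominate [gamma], which forces
   countable additivity in each argument. *)
Record coupling (gamma : set X -> set X -> R) : Prop := Coupling {
  coupling_ge0 : forall A B, measurable A -> measurable B -> 0 <= gamma A B ;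
  coupling_addl : forall B, measurable B -> additive_set_fun (gamma ^~ B) ;
  coupling_addr : forall A, measurable A -> additive_set_fun (gamma A) ;
  coupling_Tr : forall A, measurable A -> gamma A setT = pr A ;
  coupling_Tl : forall B, measurable B -> gamma setT B = pr B }.

Lemma coupling_sym gamma : coupling gamma -> coupling (fun A B => gamma B A).
Proof. by move=> [g0 gl gr gTr gTl]; split=> // A B mA mB; exact: g0. Qed.

Hypotheses (sX : standard_borel X R) (hmu : nonatomic mu).

(** Every measurable set is a preimage under [c], so it contains a given fibre or misses it; a fibre
    of positive measure would be an atom. *)
Lemma atomless_fiber (c : X -> R) t : measurable_fun setT c ->
  (forall B, measurable B -> exists2 C : set R, measurable C & B = c @^-1` C) ->
  mu (c @^-1` [set t]) = 0%E.
Proof.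
move=> mc cgen; apply: contrapT => ct0.
have mct : measurable (c @^-1` [set t]).
  by rewrite -[X in measurable X]setTI; exact: mc.
have [|_ [/cgen[C mC ->] Cct C0 Cct1]] := hmu mct.
  by rewrite lt_neqAle measure_ge0 andbT eq_sym; apply/eqP.
have [Ct|Ct] := pselect (C t).
  have ctC : c @^-1` [set t] `<=` c @^-1` C by move=> x /= ->.
  have eqC : c @^-1` C = c @^-1` [set t] by apply/seteqP.
  by move: Cct1; rewrite eqC ltxx.
have C0' : c @^-1` C = set0.
  by apply/seteqP; split=> // x Cx; apply: Ct; rewrite -(Cct x Cx).
by move: C0; rewrite C0' measure0 ltxx.
Qed.

(* The algebra generated by [s] has finitely many atoms.  Each atom [j] is cut
   into pieces of measure [gamma (atom i) (atom j)], and so is each atom [i]; [T]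
   matches the pieces of equal measure. *)
Lemma coupling_realization gamma (s : seq (set X)) : coupling gamma ->
  (forall A, A \in s -> measurable A) ->
  exists T : X -> X, [/\ measure_preserving mu T, essentially_invertible mu T &
    forall A B, A \in s -> B \in s -> pr (T @^-1` A `&` B) = gamma A B].
Proof.
move=> gammaP ms; have [c [mc c01 cgen]] := real_coding sX.
have catom t : mu (c @^-1` [set t]) = 0%E by exact: atomless_fiber.
pose n := size s; pose J := {ffun 'I_n -> bool}.
pose a x : J := [ffun k : 'I_n => `[< nth set0 s k x >]].
have ma i : measurable (a @^-1` [set i]).
  have -> : a @^-1` [set i] = \bigcap_(k in [set: 'I_n])
      (if i k then nth set0 s k else ~` nth set0 s k).
    apply/seteqP; split=> [x /= <- k _|x ix].
      by rewrite ffunE; case: asboolP.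
    apply/ffunP => k; rewrite ffunE; have := ix k I; case: (i k) => sk.
      by rewrite asboolT.
    by rewrite asboolF.
  apply: fin_bigcap_measurable => [|k _]; first exact: finite_finset.
  have mk : measurable (nth set0 s k) by apply: ms; exact: mem_nth.
  by case: (i k) => //; exact: measurableC.
pose p (i j : J) := gamma (a @^-1` [set i]) (a @^-1` [set j]).
have p0 i j : 0 <= p i j by exact: coupling_ge0.
have sumT (nu : set X -> R) : additive_set_fun nu ->
    nu setT = \sum_i nu (a @^-1` [set i]).
  move=> nuP; have /= <- := additive_set_fun_sum predT nuP ma.
  by congr nu; apply/seteqP.
have pl j : pr (a @^-1` [set j]) = \sum_i p i j.
  by rewrite -(coupling_Tl gammaP)// (sumT _ (coupling_addl gammaP (ma j))).
have pR i : pr (a @^-1` [set i]) = \sum_j p i j.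
  by rewrite -(coupling_Tr gammaP)// (sumT _ (coupling_addr gammaP (ma i))).
pose i0 : J := [ffun=> true].
have /choice[e eP] := fun j =>
  labelling_of_measures mc c01 catom i0 (p0 ^~ j) (ma j) (pl j).
have /choice[f fP] := fun i =>
  labelling_of_measures mc c01 catom i0 (p0 i) (ma i) (pR i).
(* The atom of [x] is the second component of [E x] and the first component of [F x]. Requiring
   [F (T x) = E x] therefore places [T x] in atom [i] and [x] in atom [j] exactly on the piece
   [(i, j)] of [E], which has measure [p i j]. *)
pose E x : J * J := (e (a x) x, a x).
pose F x : J * J := (a x, f (a x) x).
have EE ij : E @^-1` [set ij] = a @^-1` [set ij.2] `&` e ij.2 @^-1` [set ij.1].
  by case: ij => i j; apply/seteqP; split=> x /=; rewrite /E => -[] <- //= ->.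
have FE ij : F @^-1` [set ij] = a @^-1` [set ij.1] `&` f ij.1 @^-1` [set ij.2].
  by case: ij => i j; apply/seteqP; split=> x /=; rewrite /F => -[] <- //= ->.
have mE ij : measurable (E @^-1` [set ij]).
  by rewrite EE; apply: measurableI => //; exact: (eP _).1.
have mF ij : measurable (F @^-1` [set ij]).
  by rewrite FE; apply: measurableI => //; exact: (fP _).1.
have prE ij : pr (E @^-1` [set ij]) = p ij.1 ij.2.
  by rewrite EE (eP _).2 big_pred1_eq.
have prF ij : pr (F @^-1` [set ij]) = p ij.1 ij.2.
  by rewrite FE (fP _).2 big_pred1_eq.
have [|T [Tmp Tinv FT]] := realize_labels mc c01 cgen catom sX mF mE.
  by move=> ij; apply: pr_inj => //; rewrite prE prF.
exists T; split=> // A B As Bs.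
pose k : 'I_n := Ordinal (etrans (index_mem A s) As).
pose l : 'I_n := Ordinal (etrans (index_mem B s) Bs).
have Ak : A = [set x | a x k].
  apply/seteqP; split=> x /=; rewrite ffunE /= nth_index//; first by move/asboolT.
  by move/asboolP.
have Bl : B = [set x | a x l].
  apply/seteqP; split=> x /=; rewrite ffunE /= nth_index//; first by move/asboolT.
  by move/asboolP.
have mTA : measurable (T @^-1` A).
  by rewrite -[X in measurable X]setTI; apply: Tmp.1 => //; exact: ms.
pose Q (ij : J * J) := ij.1 k && ij.2 l.
have mQ : measurable [set x | Q (E x)] by exact: measurable_label.
have -> : pr (T @^-1` A `&` B) = pr [set x | Q (E x)].
  apply: pr_null_equal => //; first by apply: measurableI => //; exact: ms.
  apply: filterS FT => x Tx; have aT : a (T x) = (E x).1 by rewrite -Tx.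
  have AT : A (T x) <-> (E x).1 k by rewrite {1}Ak /= aT.
  have BE : B x <-> (E x).2 l by rewrite {1}Bl.
  by split => [[/AT ? /BE ?]|/andP[/AT ? /BE ?]]; first exact/andP.
rewrite (additive_set_fun_sum _ _ mE)//; last by move=> ? ? ? ?; exact: prU.
under eq_bigr do rewrite prE.
rewrite {1}Ak (additive_set_fun_sum (fun i : J => i k) (coupling_addl gammaP (ms _ Bs)) ma).
rewrite -(pair_big (fun i : J => i k) (fun j : J => j l) p)/=.
apply: eq_bigr => i _; rewrite {1}Bl.
by rewrite (additive_set_fun_sum (fun i : J => i l) (coupling_addr gammaP (ma i)) ma).
Qed.

End coupling.

(** * From couplings to homomorphisms of the measure algebra *)

Section coupling_theory.
Context d (X : measurableType d) (R : realType) (mu : probability X R).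
Local Notation pr := (pr mu).

Lemma coupling_homo (gamma : set X -> set X -> R) A A' B : coupling mu gamma ->
  measurable A -> measurable A' -> measurable B -> A `<=` A' ->
  gamma A B <= gamma A' B.
Proof.
move=> gP mA mA' mB AA'; rewrite -(setDUK AA') (coupling_addl gP)//.
- by rewrite lerDl (coupling_ge0 gP)//; exact: measurableD.
- exact: measurableD.
- by rewrite setDIK.
Qed.

Lemma coupling0 (gamma : set X -> set X -> R) B : coupling mu gamma ->
  measurable B -> gamma set0 B = 0.
Proof.
move=> gP mB; have := coupling_addl gP mB measurable0 measurable0 (setI0 _).
by rewrite setU0 => /eqP; rewrite -subr_eq0 opprD addNKr oppr_eq0 => /eqP.
Qed.

Lemma coupling_bigsetU (gamma : set X -> set X -> R) (A : (set X)^nat) B N :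
  coupling mu gamma -> (forall n, measurable (A n)) -> measurable B ->
  gamma (\big[setU/set0]_(n < N) A n) B <= \sum_(n < N) gamma (A n) B.
Proof.
move=> gP mA mB; elim: N => [|N IHN]; first by rewrite !big_ord0 (coupling0 gP).
rewrite !big_ord_recr/=; set U := \big[setU/set0]_(i < N) _.
have mU : measurable U by apply: bigsetU_measurable => i _.
rewrite -(setDUK (@subsetUl _ U (A N))) (coupling_addl gP)//; last 2 first.
- by apply: measurableD => //; exact: measurableU.
- by rewrite setDIK.
apply: lerD => //; apply: coupling_homo => //.
  by apply: measurableD => //; exact: measurableU.
by move=> x [[]].
Qed.

(** Countable subadditivity. The part [D N] not yet covered after [N] sets contributes at most its
    own measure, by the marginal condition, and decreases to the empty set. *)
Lemma coupling_bigcup_le (gamma : set X -> set X -> R) (A : (set X)^nat) B e :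
  coupling mu gamma -> (forall n, measurable (A n)) -> measurable B ->
  (forall N, \sum_(n < N) gamma (A n) B <= e) -> gamma (\bigcup_n A n) B <= e.
Proof.
move=> gP mA mB Ae.
pose U N := \big[setU/set0]_(n < N) A n; pose D N := \bigcup_n A n `\` U N.
have mU N : measurable (U N) by apply: bigsetU_measurable.
have mAU : measurable (\bigcup_n A n) by exact: bigcup_measurable.
have mD N : measurable (D N) by exact: measurableD.
have bound N : gamma (\bigcup_n A n) B <= e + pr (D N).
  rewrite -(setDUK (@bigsetU_bigcup _ A N)) (coupling_addl gP)//;
    [|exact: mU|exact: mD|by rewrite setDIK].
  apply: lerD; first exact: le_trans (coupling_bigsetU _ gP mA mB) (Ae N).
  rewrite -(coupling_Tr gP) -/(D N)//.
  by apply: (coupling_homo (coupling_sym gP)) => //; exact: mD.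
have DI : \bigcap_N D N = set0.
  apply/seteqP; split=> // x Dx; have [[n _ Anx] _] := Dx 0%N I.
  by have [_] := Dx n.+1 I; apply; rewrite /U big_ord_recr/=; right.
have D0 : (mu (D 0%N) < +oo)%E by rewrite -prE// ltry.
have Dmono : nonincreasing_seq D.
  move=> n m nm; apply/subsetPset => x [Ax Um]; split => // Un; apply: Um.
  move: Un; rewrite /U -!bigcup_mkord => -[k /= kn Akx]; exists k => //=.
  exact: leq_trans nm.
have := nonincreasing_cvg_mu (mu := mu) D0 mD (bigcapT_measurable mD) Dmono.
rewrite DI measure0 => Dcvg.
suff : ((gamma (\bigcup_n A n) B - e)%:E <= 0)%E by rewrite lee_fin subr_le0.
apply: (cvge_to_ge Dcvg); apply: nearW => N /=.
by rewrite -prE// lee_fin lerBlDl.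
Qed.

(** For the coupling of an operator P this means P 1_A = 1_E almost everywhere, as [coupling_relE]
    makes visible. *)
Definition coupling_rel (gamma : set X -> set X -> R) (A E : set X) :=
  [/\ measurable A, measurable E, gamma A (~` E) = 0 & gamma (~` A) E = 0].

Lemma coupling_rel_sym gamma A E :
  coupling_rel gamma A E -> coupling_rel (fun A B => gamma B A) E A.
Proof. by case. Qed.

Lemma coupling_bigcup0 gamma (A : (set X)^nat) B : coupling mu gamma ->
  (forall n, measurable (A n)) -> measurable B ->
  (forall n, gamma (A n) B = 0) -> gamma (\bigcup_n A n) B = 0.
Proof.
move=> gP mA mB A0; apply/eqP; rewrite eq_le (coupling_ge0 gP)//; last first.
  exact: bigcup_measurable.
rewrite andbT; apply: coupling_bigcup_le => // N.
by rewrite big1.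
Qed.

(** Shrinking [B] to its part inside [E] loses no mass, and enlarging [A] to the whole space then
    adds none; the marginal gives the value. *)
Lemma coupling_relE gamma A E B : coupling mu gamma -> coupling_rel gamma A E ->
  measurable B -> gamma A B = pr (E `&` B).
Proof.
move=> gP [mA mE AE0 AE0'] mB.
have gle0 C D C' D' : measurable C -> measurable D -> measurable C' -> measurable D' ->
    C `<=` C' -> D `<=` D' -> gamma C' D' = 0 -> gamma C D = 0.
  move=> mC mD mC' mD' CC' DD' H; apply/eqP; rewrite eq_le (coupling_ge0 gP)//.
  rewrite andbT -H; apply: (le_trans (coupling_homo gP mC mC' mD CC')).
  exact: (coupling_homo (coupling_sym gP)).
have mEB : measurable (E `&` B) by exact: measurableI.
have mEB' : measurable (B `\` E) by exact: measurableD.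
have mCA : measurable (~` A) by exact: measurableC.
have mCE : measurable (~` E) by exact: measurableC.
rewrite -[in LHS](setUIDK B E) (coupling_addr gP)//; last 2 first.
- exact: measurableI.
- by apply/seteqP; split=> x //= [[]] _ ? [].
rewrite (@gle0 A (B `\` E) A (~` E))// addr0 setIC.
rewrite -(coupling_Tl gP)// -(setUv A) (coupling_addl gP)// ?setICr//.
by rewrite (@gle0 (~` A) (E `&` B) (~` A) E)// addr0.
Qed.

Lemma coupling_measure_relation gamma : coupling mu gamma ->
  measure_relation mu (coupling_rel gamma).
Proof.
move=> gP; split=> [A E AE|A E [mA mE AE EA]|A E AE].
- have [mA mE _ _] := AE; split=> //; apply: pr_inj => //.
  by rewrite -(coupling_Tr gP)// (coupling_relE gP AE)// setIT.
- by split; rewrite ?setCK//; exact: measurableC.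
- have mA n : measurable (A n) by case: (AE n).
  have mE n : measurable (E n) by case: (AE n).
  have mUA : measurable (\bigcup_n A n) by exact: bigcup_measurable.
  have mUE : measurable (\bigcup_n E n) by exact: bigcup_measurable.
  (* One of the two vanishing conditions, for an arbitrary coupling; the other one is the same
     statement for the transposed coupling. *)
  have half g (F G : (set X)^nat) : coupling mu g -> (forall n, measurable (F n)) ->
      (forall n, measurable (G n)) -> (forall n, g (F n) (~` G n) = 0) ->
      g (\bigcup_n F n) (~` \bigcup_n G n) = 0.
    move=> gP' mF mG FG; have mUG : measurable (~` \bigcup_n G n).
      by apply: measurableC; exact: bigcup_measurable.
    apply: coupling_bigcup0 => // n; apply/eqP.
    rewrite eq_le (coupling_ge0 gP')// andbT -(FG n).
    apply: (coupling_homo (coupling_sym gP')) => //; first exact: measurableC.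
    by move=> x Gx Gnx; apply: Gx; exists n.
  split=> //; first by apply: half => // n; case: (AE n).
  by apply: (half _ _ _ (coupling_sym gP)) => // n; case: (AE n).
Qed.

(** The witness is the upper limit of sets [E n] with errors below 2^-n. Its complement is the union
    of the complements of the [F m], each contained in the complement of every later [E n]; the
    witness itself lies in every [F m], whose error is bounded by a geometric tail. *)
Lemma coupling_rel_limit gamma A : coupling mu gamma -> measurable A ->
  (forall e, 0 < e -> exists2 E, measurable E & gamma A (~` E) + gamma (~` A) E < e) ->
  exists E, coupling_rel gamma A E.
Proof.
move=> gP mA Ae; have mCA : measurable (~` A) by exact: measurableC.
pose h n : R := 2^-1 ^+ n; have h0 n : 0 < h n by rewrite exprn_gt0// invr_gt0.
have hcvg : h @ \oo --> (0 : R).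
  by apply: cvg_expr; rewrite ger0_norm ?invr_ge0// invf_lt1// ltr1n.
have /choice[E EP] n : exists E, measurable E /\ gamma A (~` E) + gamma (~` A) E < h n.
  by have [E ? ?] := Ae _ (h0 n); exists E.
have mE n : measurable (E n) by case: (EP n).
have mCE n : measurable (~` E n) by exact: measurableC.
have gAE n : gamma A (~` E n) < h n.
  by have [_] := EP n; apply: le_lt_trans; rewrite lerDl (coupling_ge0 gP).
have gEA n : gamma (~` A) (E n) < h n.
  by have [_] := EP n; apply: le_lt_trans; rewrite lerDr (coupling_ge0 gP).
pose F m := \bigcup_n E (m + n)%N.
have mF m : measurable (F m) by exact: bigcup_measurable.
have mCF m : measurable (~` F m) by exact: measurableC.
have mIF : measurable (\bigcap_m F m) by exact: bigcapT_measurable.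
exists (\bigcap_m F m); split=> //.
- rewrite setC_bigcap; apply: (coupling_bigcup0 (coupling_sym gP)) => // m.
  apply/eqP; rewrite eq_le (coupling_ge0 gP)// andbT.
  apply: (cvgr_to_ge hcvg); exists m => // n /= mn; apply: ltW.
  apply: le_lt_trans (gAE n); apply: (coupling_homo (coupling_sym gP)) => //.
  by move=> x Fx Ex; apply: Fx; exists (n - m)%N => //; rewrite subnKC.
- apply/eqP; rewrite eq_le (coupling_ge0 gP)// andbT.
  have h2 : (2 * h m @[m --> \oo]) --> (0 : R).
    by rewrite -[X in _ --> X](mulr0 2); apply: cvgM => //; exact: cvg_cst.
  apply: (cvgr_to_ge h2); apply: nearW => m /=.
  apply: (@le_trans _ _ (gamma (~` A) (F m))).
    by apply: (coupling_homo (coupling_sym gP)) => // x; exact.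
  apply: (coupling_bigcup_le (coupling_sym gP)) => // N.
  (* The exact geometric sum is kept on the right, so that induction on [N] goes through; the bound
     [2 * h m] alone would not be inductive. *)
  suff: \sum_(n < N) gamma (~` A) (E (m + n)%N) <= 2 * h m - 2 * h (m + N)%N.
    by move/le_trans; apply; rewrite gerBl mulr_ge0// ltW.
  elim: N => [|N IHN]; first by rewrite big_ord0 addn0 subrr.
  rewrite big_ord_recr/=; apply: le_trans (lerD IHN (ltW (gEA _))) _.
  rewrite addnS /h exprS mulrA mulfV// mul1r; lra.
Qed.

End coupling_theory.

(** * The real bilinear form of an operator *)

Section real_L2.
Context d (X : measurableType d) (R : realType) (mu : probability X R).
Implicit Types (f g h : X -> R) (A B : set X).

Local Notation sq := (Lfun mu 2%:E).

Lemma Lfun2P f : f \in sq <-> measurable_fun setT f /\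
  mu.-integrable setT (EFin \o (fun x => f x ^+ 2)).
Proof.
split=> [sf|[mf if2]].
  by split; [exact: Lfun_measurable sf|exact: Lfun2_integrable_sqr].
rewrite inE; apply/andP; split; rewrite inE//= /finite_norm unlock poweR_lty//.
under eq_integral => x _ do rewrite /= powR_mulrn// real_normK ?num_real//.
exact: integrable_lty.
Qed.

Lemma Lfun2_le f g : measurable_fun setT f -> (forall x, `|f x| <= `|g x|) ->
  g \in sq -> f \in sq.
Proof.
move=> mf fg /Lfun2P[mg ig]; apply/Lfun2P; split=> //.
apply: le_integrable ig => //; first exact/measurable_EFinP/measurable_funX.
move=> x _ /=; rewrite lee_fin !normrX lerXn2r ?nnegrE//.
Qed.

Lemma Lfun2_cst (c : R) : (fun=> c) \in sq.
Proof. exact: Lfun_cst. Qed.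

Lemma Lfun2_bounded f M : measurable_fun setT f -> (forall x, `|f x| <= M) -> f \in sq.
Proof.
move=> mf fM; apply: (@Lfun2_le f (fun=> M)) => //; last exact: Lfun2_cst.
by move=> x; rewrite (le_trans (fM x))// ler_norm.
Qed.

Lemma Lfun2_indic A : measurable A -> (\1_A : X -> R) \in sq.
Proof.
move=> mA; apply: (@Lfun2_bounded _ 1); first exact: measurable_indic.
by move=> x; rewrite indicE; case: (x \in A); rewrite ?normr1// normr0.
Qed.

Lemma Lfun2_lin (a : R) f g : f \in sq -> g \in sq -> (fun x => a * f x + g x) \in sq.
Proof. by move=> sf sg; have [_ LS] := Lfun_submod_closed mu (lee1n 2); exact: LS. Qed.

Lemma Lfun2B f g : f \in sq -> g \in sq -> (fun x => f x - g x) \in sq.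
Proof.
move=> sf sg; have := Lfun2_lin (-1) sg sf.
by under eq_fun do rewrite mulN1r addrC.
Qed.

Lemma Lfun2Z (a : R) f : f \in sq -> (fun x => a * f x) \in sq.
Proof.
move=> sf; have := Lfun2_lin a sf (Lfun2_cst 0).
by under eq_fun do rewrite addr0.
Qed.

Lemma Lfun2_mul f g : f \in sq -> g \in sq -> (fun x => f x * g x) \in Lfun mu 1.
Proof. exact: Lfun2_mul_Lfun1. Qed.

Lemma Lfun2_sqr f : f \in sq -> (fun x => f x ^+ 2) \in Lfun mu 1.
Proof. by move=> sf; apply/Lfun1_integrable; exact: Lfun2_integrable_sqr. Qed.

Lemma Lfun21 f : f \in sq -> f \in Lfun mu 1.
Proof. exact: (Lfun_subset12 (fin_num_measure mu _ measurableT)). Qed.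

Lemma Lfun1_meas f : f \in Lfun mu 1 -> measurable_fun setT f.
Proof. by case/andP => /set_mem. Qed.

Lemma Lfun1_lin (a : R) f g : f \in Lfun mu 1 -> g \in Lfun mu 1 ->
  (fun x => a * f x + g x) \in Lfun mu 1.
Proof. by move=> sf sg; have [_ LS] := Lfun_submod_closed mu (lexx 1%E); exact: LS. Qed.

Lemma Lfun1Z (a : R) f : f \in Lfun mu 1 -> (fun x => a * f x) \in Lfun mu 1.
Proof.
move=> sf; have := Lfun1_lin a sf (Lfun21 (Lfun2_cst 0)).
by under eq_fun do rewrite addr0.
Qed.

Lemma Lfun1D f g : f \in Lfun mu 1 -> g \in Lfun mu 1 -> (fun x => f x + g x) \in Lfun mu 1.
Proof.
move=> sf sg; have := Lfun1_lin 1 sf sg.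
by under eq_fun do rewrite mul1r.
Qed.

Lemma Rintegral_lin (a : R) f g : f \in Lfun mu 1 -> g \in Lfun mu 1 ->
  \int[mu]_x (a * f x + g x) = a * (\int[mu]_x f x) + \int[mu]_x g x.
Proof.
move=> sf sg; rewrite RintegralD ?RintegralZl//.
- exact/Lfun1_integrable.
- by apply/Lfun1_integrable; exact: Lfun1Z.
- exact/Lfun1_integrable.
Qed.

Lemma ae_ge0_Rintegral f : measurable_fun setT f -> {ae mu, forall x, 0 <= f x} ->
  0 <= \int[mu]_x f x.
Proof.
move=> mf f0; rewrite (@ae_eq_Rintegral _ _ _ _ f (fun x => `|f x|))//.
- by apply: Rintegral_ge0.
- exact: measurableT_comp.
- by apply: filterS f0 => x /ger0_norm.
Qed.

Lemma ae_le_Rintegral f g : f \in Lfun mu 1 -> g \in Lfun mu 1 ->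
  {ae mu, forall x, f x <= g x} -> \int[mu]_x f x <= \int[mu]_x g x.
Proof.
move=> sf sg fg; rewrite -subr_ge0.
have := @ae_ge0_Rintegral (fun x => -1 * f x + g x).
rewrite Rintegral_lin// mulN1r addrC; apply.
  exact: Lfun1_meas (Lfun1_lin _ sf sg).
by apply: filterS fg => x; rewrite mulN1r addrC subr_ge0.
Qed.

Lemma Rintegral_indic A : measurable A -> \int[mu]_x (\1_A x : R) = pr mu A.
Proof. by move=> mA; rewrite /Rintegral integral_indic// setIT. Qed.

Lemma Rdominated_cvg (f_ : (X -> R)^nat) f g : (forall n, measurable_fun setT (f_ n)) ->
  (forall x, f_ n x @[n --> \oo] --> f x) -> (forall n x, `|f_ n x| <= g x) ->
  g \in Lfun mu 1 -> \int[mu]_x f_ n x @[n --> \oo] --> \int[mu]_x f x.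
Proof.
move=> mf ff fg /Lfun1_integrable ig.
have mF : measurable_fun setT f.
  by apply: (measurable_fun_cvg mf) => x _; exact: ff.
have fgx x : `|f x| <= g x.
  apply: (cvgr_to_le (cvg_norm (ff x))); exact: nearW.
have iF : mu.-integrable setT (EFin \o f).
  apply: le_integrable ig => //; first exact/measurable_EFinP.
  by move=> x _ /=; rewrite lee_fin (le_trans (fgx x))// ler_norm.
rewrite /Rintegral; apply: fine_cvg.
rewrite fineK; last exact: integrable_fin_num.
apply: (@dominated_cvg _ _ _ _ _ _ (fun n => EFin \o f_ n) _ (EFin \o g)) => //.
- by move=> n; exact/measurable_EFinP.
- by move=> x _; apply: cvg_EFin; [exact: nearW|exact: ff].
- by move=> n x _ /=; rewrite lee_fin.
Qed.

End real_L2.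

Section scalar_theory.
Context (R : realType) (k : scalar_kind).
Implicit Types z w : scalar_field R k.

Lemma scalar_re_mk (a b : R) : scalar_re (scalar_mk k a b) = a.
Proof. by case: k. Qed.

Lemma scalar_im_mk0 (a : R) : scalar_im (scalar_mk k a 0) = 0.
Proof. by case: k. Qed.

Lemma scalar_eq z w : scalar_re z = scalar_re w -> scalar_im z = scalar_im w -> z = w.
Proof. by case: k z w => [//|[a b] [a' b'] /= -> ->]. Qed.

Lemma scalar_ge0 z : (0 <= z) = (scalar_im z == 0) && (0 <= scalar_re z).
Proof. by case: k z => [z|z] /=; rewrite ?eqxx// lecE. Qed.

(** [scalar_mk k 0 1] is the imaginary unit over [R[i]] and collapses to 0 over [R], where imaginary
    parts vanish anyway; this lets [op_decomp] treat both fields together. *)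
Lemma scalar_im_unit : scalar_im (scalar_mk k 0 (1 : R)) = 1 \/
  scalar_im (scalar_mk k 0 (1 : R)) = 0 /\ forall z, scalar_im z = 0.
Proof. by case: k; [right|left]. Qed.

End scalar_theory.

Section operator_form.
Context d (X : measurableType d) (R : realType) (mu : probability X R).
Variable k : scalar_kind.
Local Notation K := (scalar_field R k).
Local Notation L2 := (L2 mu k).
Local Notation sq := (Lfun mu 2%:E).
Implicit Types (a b c : X -> R) (f g : L2) (P : {linear L2 -> L2}).

Lemma L2_re_Lfun f : (fun x => scalar_re (f x)) \in sq.
Proof. exact: sqintegrable_re (L2_sqintegrable f). Qed.

Lemma L2_im_Lfun f : (fun x => scalar_im (f x)) \in sq.
Proof. exact: sqintegrable_im (L2_sqintegrable f). Qed.

Definition real_lift a : X -> K := fun x => scalar_mk k (a x) 0.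

Lemma real_lift_sqintegrable a : a \in sq -> real_lift a \in @sqintegrable _ X R mu k.
Proof.
move=> sa; apply/andP; split.
  by rewrite [X in X \in _](_ : _ = a)//; apply/funext => x; exact: scalar_re_mk.
rewrite [X in X \in _](_ : _ = fun=> 0) ?Lfun2_cst//.
by apply/funext => x; exact: scalar_im_mk0.
Qed.

(* [insubd] makes [iota a] equal to 0 when [a] is not square integrable. *)
Definition iota a : L2 := toL2 (insubd (0 : sqfun mu k) (real_lift a)).

Lemma iotaE a : a \in sq -> {ae mu, forall x, iota a x = scalar_mk k (a x) 0}.
Proof.
move=> sa; have := toL2K (insubd (0 : sqfun mu k) (real_lift a)).
have -> : sqfun_fun (insubd (0 : sqfun mu k) (real_lift a)) = real_lift a.
  by apply: insubdK; exact: real_lift_sqintegrable.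
by [].
Qed.

Lemma iota_lin (r : R) a b : a \in sq -> b \in sq ->
  iota (fun x => r * a x + b x) = scalar_mk k r 0 *: iota a + iota b.
Proof.
move=> sa sb; apply: L2P.
have H1 := L2_addE (scalar_mk k r 0 *: iota a) (iota b).
have H2 := L2_scalerE (scalar_mk k r 0) (iota a).
have H3 := iotaE (Lfun2_lin r sa sb).
apply: filterS2 (filterI H1 H2) (filterI H3 (filterI (iotaE sa) (iotaE sb))).
move=> x [-> ->] [-> [-> ->]]; apply: scalar_eq.
  by rewrite scalar_reD scalar_reM !scalar_re_mk !scalar_im_mk0 mulr0 subr0.
by rewrite scalar_imD scalar_imM !scalar_im_mk0 mulr0 mul0r !addr0.
Qed.

Lemma iota1 : iota (fun=> 1) = L2_one mu k.
Proof.
apply: L2P; have one := toL2K (SqFun (sqintegrable_cst1 mu k)).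
apply: filterS2 (iotaE (Lfun2_cst mu 1)) one => x -> -> /=.
by case: k.
Qed.

Definition inner_re f g : R := scalar_re (L2_inner f g).

Lemma inner_reE f g : inner_re f g =
  \int[mu]_x (scalar_re (f x) * scalar_re (g x) + scalar_im (f x) * scalar_im (g x)).
Proof.
rewrite /inner_re scalar_re_mk; apply: eq_Rintegral => x _.
exact: scalar_re_mul_conj.
Qed.

Lemma inner_re_iota f b : b \in sq ->
  inner_re f (iota b) = \int[mu]_x (scalar_re (f x) * b x).
Proof.
move=> sb; rewrite inner_reE; apply: ae_eq_Rintegral.
- by apply: (@Lfun1_meas _ _ _ mu); apply: Lfun1D; apply: Lfun2_mul;
    first [exact: L2_re_Lfun|exact: L2_im_Lfun].
- by apply: (@Lfun1_meas _ _ _ mu); apply: Lfun2_mul => //; exact: L2_re_Lfun.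
- apply: filterS (iotaE sb) => x ->.
  by rewrite scalar_re_mk scalar_im_mk0 mulr0 addr0.
Qed.

Definition op_re P a : X -> R := fun x => scalar_re ((P (iota a) : L2) x).

(** Arguments are plain real functions and not classes, so that indicators, truncations and simple
    functions can be substituted directly. *)
Definition form P a b : R := inner_re (P (iota a)) (iota b).

Lemma op_re_Lfun P a : op_re P a \in sq.
Proof. exact: L2_re_Lfun. Qed.

Lemma formE P a b : b \in sq -> form P a b = \int[mu]_x (op_re P a x * b x).
Proof. exact: inner_re_iota. Qed.

Lemma op_re_lin P r a b : a \in sq -> b \in sq ->
  {ae mu, forall x, op_re P (fun x => r * a x + b x) x = r * op_re P a x + op_re P b x}.
Proof.
move=> sa sb; rewrite /op_re iota_lin// linearP.
apply: filterS2 (L2_addE (scalar_mk k r 0 *: P (iota a)) (P (iota b)))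
  (L2_scalerE (scalar_mk k r 0) (P (iota a))) => x -> ->.
by rewrite scalar_reD scalar_reM scalar_re_mk scalar_im_mk0 mul0r subr0.
Qed.

Lemma form_linl P r a b c : a \in sq -> b \in sq -> c \in sq ->
  form P (fun x => r * a x + b x) c = r * form P a c + form P b c.
Proof.
move=> sa sb sc; rewrite !formE// -Rintegral_lin; last 2 first.
- by apply: Lfun2_mul => //; exact: op_re_Lfun.
- by apply: Lfun2_mul => //; exact: op_re_Lfun.
apply: ae_eq_Rintegral.
- by apply: (@Lfun1_meas _ _ _ mu); apply: Lfun2_mul => //; exact: op_re_Lfun.
- by apply: (@Lfun1_meas _ _ _ mu); apply: Lfun1_lin; apply: Lfun2_mul => //; exact: op_re_Lfun.
- by apply: filterS (op_re_lin P r sa sb) => x ->; rewrite mulrDl mulrA.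
Qed.

Lemma form_linr P r a b c : b \in sq -> c \in sq ->
  form P a (fun x => r * b x + c x) = r * form P a b + form P a c.
Proof.
move=> sb sc; rewrite !formE//; last exact: Lfun2_lin.
rewrite -Rintegral_lin; last 2 first.
- by apply: Lfun2_mul => //; exact: op_re_Lfun.
- by apply: Lfun2_mul => //; exact: op_re_Lfun.
by apply: eq_Rintegral => x _; rewrite mulrDr mulrCA.
Qed.

Lemma form0l P c : c \in sq -> form P (fun=> 0) c = 0.
Proof.
move=> sc; have := form_linl P (-1) (Lfun2_cst mu 0) (Lfun2_cst mu 0) sc.
by under eq_fun do rewrite mulr0 addr0; rewrite mulN1r addNr.
Qed.

Lemma form0r P a : form P a (fun=> 0) = 0.
Proof.
have := form_linr P (-1) a (Lfun2_cst mu 0) (Lfun2_cst mu 0).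
by under eq_fun do rewrite mulr0 addr0; rewrite mulN1r addNr.
Qed.

Lemma formZl P r a c : a \in sq -> c \in sq ->
  form P (fun x => r * a x) c = r * form P a c.
Proof.
move=> sa sc; have := form_linl P r sa (Lfun2_cst mu 0) sc.
by under eq_fun do rewrite addr0; rewrite form0l// addr0.
Qed.

Lemma formZr P r a b : b \in sq -> form P a (fun x => r * b x) = r * form P a b.
Proof.
move=> sb; have := form_linr P r a sb (Lfun2_cst mu 0).
by under eq_fun do rewrite addr0; rewrite form0r addr0.
Qed.

Lemma formDl P a b c : a \in sq -> b \in sq -> c \in sq ->
  form P (fun x => a x + b x) c = form P a c + form P b c.
Proof.
move=> sa sb sc; have := form_linl P 1 sa sb sc.
by under eq_fun do rewrite mul1r; rewrite mul1r.
Qed.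

Lemma formDr P a b c : b \in sq -> c \in sq ->
  form P a (fun x => b x + c x) = form P a b + form P a c.
Proof.
move=> sb sc; have := form_linr P 1 a sb sc.
by under eq_fun do rewrite mul1r; rewrite mul1r.
Qed.

Lemma formBl P a b c : a \in sq -> b \in sq -> c \in sq ->
  form P (fun x => a x - b x) c = form P a c - form P b c.
Proof.
move=> sa sb sc; have := form_linl P (-1) sb sa sc.
by under eq_fun do rewrite mulN1r addrC; rewrite mulN1r addrC.
Qed.

Lemma formBr P a b c : b \in sq -> c \in sq ->
  form P a (fun x => b x - c x) = form P a b - form P a c.
Proof.
move=> sb sc; have := form_linr P (-1) a sc sb.
by under eq_fun do rewrite mulN1r addrC; rewrite mulN1r addrC.
Qed.

Section positive.
Variable P : {linear L2 -> L2}.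
Hypothesis P0 : positive_operator P.

Lemma op_ge0 a : a \in sq -> (forall x, 0 <= a x) ->
  {ae mu, forall x, 0 <= (P (iota a) : L2) x}.
Proof.
move=> sa a0; apply: P0; apply: filterS (iotaE sa) => x ->.
by rewrite scalar_ge0 scalar_re_mk scalar_im_mk0 eqxx a0.
Qed.

Lemma op_re_ge0 a : a \in sq -> (forall x, 0 <= a x) ->
  {ae mu, forall x, 0 <= op_re P a x}.
Proof.
move=> sa a0; apply: filterS (op_ge0 sa a0) => x.
by rewrite scalar_ge0 => /andP[].
Qed.

(** [a] is the difference of the nonnegative functions [|a|] and [|a| - a], and [0 <= z] already
    forces [z] to be real. *)
Lemma op_im a : a \in sq -> {ae mu, forall x, scalar_im ((P (iota a) : L2) x) = 0}.
Proof.
move=> sa; have sN : (fun x => `|a x|) \in sq.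
  apply: (Lfun2_le _ _ sa) => [|x]; last by rewrite normr_id.
  by apply: measurableT_comp => //; exact: Lfun_measurable sa.
have sD : (fun x => `|a x| - a x) \in sq by exact: Lfun2B.
have E : iota a = scalar_mk k (-1) 0 *: iota (fun x => `|a x| - a x) + iota (fun x => `|a x|).
  by rewrite -iota_lin//; congr iota; apply/funext => x; ring.
have H1 := op_ge0 sN (fun x => normr_ge0 _).
have H2 : {ae mu, forall x, 0 <= (P (iota (fun x => `|a x| - a x)) : L2) x}.
  by apply: op_ge0 => // x; rewrite subr_ge0 ler_norm.
rewrite E linearP.
set u := P (iota (fun x => `|a x| - a x)); set v := P (iota (fun x => `|a x|)).
apply: filterS2 (filterI H1 H2) (filterI (L2_addE (scalar_mk k (-1) 0 *: u) v)
  (L2_scalerE (scalar_mk k (-1) 0) u)).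
move=> x [+ +] [-> ->]; rewrite !scalar_ge0 => /andP[/eqP i1 _] /andP[/eqP i2 _].
by rewrite scalar_imD scalar_imM i1 i2 scalar_im_mk0 mulr0 mul0r !addr0.
Qed.

Lemma form_ge0 a b : a \in sq -> b \in sq -> (forall x, 0 <= a x) ->
  (forall x, 0 <= b x) -> 0 <= form P a b.
Proof.
move=> sa sb a0 b0; rewrite formE//; apply: ae_ge0_Rintegral.
  by apply: (@Lfun1_meas _ _ _ mu); apply: Lfun2_mul => //; exact: op_re_Lfun.
by apply: filterS (op_re_ge0 sa a0) => x H; rewrite mulr_ge0.
Qed.

Let i : K := scalar_mk k 0 1.

Let L2_decomp f :
  f = i *: iota (fun x => scalar_im (f x)) + iota (fun x => scalar_re (f x)).
Proof.
set u := iota _; set v := iota _; apply: L2P.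
apply: filterS2 (filterI (L2_addE (i *: u) v) (L2_scalerE i u))
  (filterI (iotaE (L2_im_Lfun f)) (iotaE (L2_re_Lfun f))) => x [-> ->] [-> ->].
rewrite /i; case: k f {u v} => f /=; first by rewrite mul0r add0r.
by case: (f x) => p q; apply/eqP; rewrite eq_complex /= !mul0r !mul1r subr0 !add0r addr0 !eqxx.
Qed.

Lemma op_decomp f : {ae mu, forall x,
  scalar_re ((P f : L2) x) = op_re P (fun x => scalar_re (f x)) x /\
  scalar_im ((P f : L2) x) = op_re P (fun x => scalar_im (f x)) x}.
Proof.
(* Over [R[i]] the factor is 1. Over [R] it is 0, and the right-hand side vanishes too, being the
   image of the zero function. *)
have real0 : {ae mu, forall x, scalar_im i * op_re P (fun x => scalar_im (f x)) x =
    op_re P (fun x => scalar_im (f x)) x}.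
  have [->|[-> im0]] := scalar_im_unit R k; first by apply: aeW => x; rewrite mul1r.
  have := op_re_lin P (-1) (L2_im_Lfun f) (L2_im_Lfun f).
  have -> : (fun x => -1 * scalar_im (f x) + scalar_im (f x)) = (fun x => scalar_im (f x)).
    by apply/funext => x; rewrite im0 mulr0 addr0.
  by apply: filterS => x ->; rewrite mul0r mulN1r addNr.
pose u : L2 := P (iota (fun x => scalar_im (f x))).
pose v : L2 := P (iota (fun x => scalar_re (f x))).
have H1 : {ae mu, forall x, (P f : L2) x = i * u x + v x}.
  rewrite (_ : P f = i *: u + v); last by rewrite {1}(L2_decomp f) linearP.
  by apply: filterS2 (L2_addE (i *: u) v) (L2_scalerE i u) => x -> ->.
apply: filterS2 (filterI H1 real0)
  (filterI (op_im (L2_im_Lfun f)) (op_im (L2_re_Lfun f))) => x [-> <-] [i1 i2].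
rewrite scalar_reD scalar_imD scalar_reM scalar_imM /u /v i1 i2.
by rewrite !scalar_re_mk !mulr0 !mul0r subr0 !add0r addr0.
Qed.

(** Reduces the matrix coefficients of a positive operator, hence weak convergence, to the real
    form. *)
Lemma L2_inner_form f g : L2_inner (P f) g = scalar_mk k
  (form P (fun x => scalar_re (f x)) (fun x => scalar_re (g x)) +
   form P (fun x => scalar_im (f x)) (fun x => scalar_im (g x)))
  (form P (fun x => scalar_im (f x)) (fun x => scalar_re (g x)) -
   form P (fun x => scalar_re (f x)) (fun x => scalar_im (g x))).
Proof.
have op1 a g' : (fun x => op_re P a x * scalar_re ((g' : L2) x)) \in Lfun mu 1.
  by apply: Lfun2_mul; [exact: op_re_Lfun|exact: L2_re_Lfun].
have op2 a g' : (fun x => op_re P a x * scalar_im ((g' : L2) x)) \in Lfun mu 1.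
  by apply: Lfun2_mul; [exact: op_re_Lfun|exact: L2_im_Lfun].
rewrite !formE ?L2_re_Lfun ?L2_im_Lfun// /L2_inner; congr (scalar_mk k _ _).
- rewrite -RintegralD//; [|exact/Lfun1_integrable..].
  under eq_Rintegral do rewrite scalar_re_mul_conj.
  apply: ae_eq_Rintegral.
  + apply: (@Lfun1_meas _ _ _ mu); apply: Lfun1D; apply: Lfun2_mul;
      first [exact: L2_re_Lfun|exact: L2_im_Lfun].
  + by apply: (@Lfun1_meas _ _ _ mu); exact: Lfun1D.
  + by apply: filterS (op_decomp f) => x [-> ->].
- rewrite -RintegralB//; [|exact/Lfun1_integrable..].
  under eq_Rintegral do rewrite scalar_im_mul_conj.
  apply: ae_eq_Rintegral.
  + apply: measurable_funB; apply: (@Lfun1_meas _ _ _ mu); apply: Lfun2_mul;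
      first [exact: L2_re_Lfun|exact: L2_im_Lfun].
  + by apply: measurable_funB; exact: (@Lfun1_meas _ _ _ mu).
  + by apply: filterS (op_decomp f) => x [-> ->].
Qed.

End positive.

Section bistochastic.
Variable P : {linear L2 -> L2}.
Hypothesis PBS : bistochastic P.

Let P0 : positive_operator P. Proof. by case: PBS. Qed.

Lemma form1l b : b \in sq -> form P (fun=> 1) b = \int[mu]_x b x.
Proof.
move=> sb; have [_ P1 _] := PBS.
rewrite /form iota1 P1 -iota1 inner_re_iota//; apply: ae_eq_Rintegral.
- by apply: (@Lfun1_meas _ _ _ mu); apply: Lfun2_mul => //; exact: L2_re_Lfun.
- exact: Lfun_measurable sb.
- apply: filterS (iotaE (Lfun2_cst mu 1)) => x ->.
  by rewrite scalar_re_mk mul1r.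
Qed.

Lemma form1r a : a \in sq -> form P a (fun=> 1) = \int[mu]_x a x.
Proof.
move=> sa; have [_ _ PT1] := PBS.
rewrite /form iota1 /inner_re PT1 -iota1 -/(inner_re _ _) inner_re_iota ?Lfun2_cst//.
apply: ae_eq_Rintegral.
- by apply: (@Lfun1_meas _ _ _ mu); apply: Lfun2_mul; [exact: L2_re_Lfun|exact: Lfun2_cst].
- exact: Lfun_measurable sa.
- by apply: filterS (iotaE sa) => x ->; rewrite scalar_re_mk mulr1.
Qed.

End bistochastic.

End operator_form.

(** * Contraction and approximation by simple functions *)

Section square_bound.
Context (R : realType).

(** [y ^+ 2] is the supremum over [q] of the tangent values [2 * q * y - q ^+ 2], and rational [q]
    near [y] suffice. Capping [e] at 1 turns [q - y < e] into [(q - y) ^+ 2 < e]. *)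
Lemma sqr_le_rat (y z : R) : (forall q : rat, 2 * ratr q * y <= z + ratr q ^+ 2) ->
  y ^+ 2 <= z.
Proof.
move=> H; rewrite leNgt; apply/negP => zy.
pose e := Num.min 1 (y ^+ 2 - z).
have e0 : 0 < e by rewrite lt_min ltr01 subr_gt0.
have [|q] := @rat_in_itvoo _ y (y + e); first by rewrite ltrDl.
rewrite in_itv/= => /andP[yq qye]; have := H q; apply/negP; rewrite -ltNge.
have qy : 0 < ratr q - y < e by rewrite subr_gt0 yq ltrBlDl qye.
have : (ratr q - y) ^+ 2 < e.
  rewrite expr2 (@lt_le_trans _ _ (e * 1))//; last by rewrite mulr1.
  by rewrite ltr_pM//; [lra..|]; rewrite (@lt_le_trans _ _ e)//; [lra|rewrite ge_min lexx].
have : e <= y ^+ 2 - z by rewrite ge_min lexx orbT.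
rewrite !expr2 => h1 h2; nra.
Qed.

End square_bound.

Section contraction.
Context d (X : measurableType d) (R : realType) (mu : probability X R).
Variable k : scalar_kind.
Local Notation L2 := (L2 mu k).
Local Notation sq := (Lfun mu 2%:E).
Implicit Types (a b c : X -> R) (P Q : {linear L2 -> L2}).

Definition truncate a n : X -> R := fun x => Num.min (a x) n%:R.

Lemma measurable_truncate a n : measurable_fun setT a -> measurable_fun setT (truncate a n).
Proof. by move=> ma; apply: measurable_minr => //; exact: measurable_cst. Qed.

Lemma truncate_ge0 a n x : 0 <= a x -> 0 <= truncate a n x.
Proof. by move=> a0; rewrite le_min a0 ler0n. Qed.

Lemma truncate_le a n x : truncate a n x <= a x.
Proof. by rewrite ge_min lexx. Qed.

Lemma truncate_Lfun a n : a \in sq -> (forall x, 0 <= a x) -> truncate a n \in sq.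
Proof.
move=> sa a0; apply: (Lfun2_le _ _ sa) => [|x].
  exact/measurable_truncate/(Lfun_measurable sa).
by rewrite !ger0_norm ?truncate_ge0// truncate_le.
Qed.

Lemma truncate_cvg a x : truncate a n x @[n --> \oo] --> a x.
Proof.
apply: cvg_near_cst; have [m _ mP] : \forall n \near \oo, a x <= n%:R.
  exact: nbhs_infty_ger.
by exists m => // n /mP; rewrite /truncate/= => /min_l ->.
Qed.

Lemma truncate_Rintegral_cvg a h : a \in sq -> h \in sq -> (forall x, 0 <= a x) ->
  \int[mu]_x (h x * truncate a n x) @[n --> \oo] --> \int[mu]_x (h x * a x).
Proof.
move=> sa sh a0; apply: (@Rdominated_cvg _ _ _ _ _ _ (fun x => `|h x * a x|)).
- move=> n; apply: measurable_funM; [exact: Lfun_measurable sh|].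
  by apply: measurable_truncate; exact: Lfun_measurable sa.
- by move=> x; apply: cvgMr; exact: truncate_cvg.
- move=> n x; rewrite !normrM ler_wpM2l// !ger0_norm ?truncate_ge0//.
  exact: truncate_le.
- by apply: Lfun_norm; exact: Lfun2_mul.
Qed.

Section bistochastic.
Variable P : {linear L2 -> L2}.
Hypothesis PBS : bistochastic P.

Let P0 : positive_operator P. Proof. by case: PBS. Qed.

Lemma op_re1 : {ae mu, forall x, op_re P (fun=> 1) x = 1}.
Proof.
have [_ P1 _] := PBS; rewrite /op_re iota1 P1 -iota1.
by apply: filterS (iotaE k (Lfun2_cst mu 1)) => x ->; rewrite scalar_re_mk.
Qed.

(** Jensen's inequality for [P]: positivity is applied to [(q - a) ^+ 2] and expanded with
    [P 1 = 1]. Taking [q] rational leaves countably many null sets, after which [q] is optimised at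
    each point. *)
Lemma op_re_sqr_le a : a \in sq -> (fun x => a x ^+ 2) \in sq ->
  {ae mu, forall x, op_re P a x ^+ 2 <= op_re P (fun x => a x ^+ 2) x}.
Proof.
move=> sa sa2.
have H (q : rat) : {ae mu, forall x,
    2 * ratr q * op_re P a x <= op_re P (fun x => a x ^+ 2) x + ratr q ^+ 2}.
  pose r : R := ratr q.
  have s1 := Lfun2_lin (r ^+ 2) (Lfun2_cst mu 1) sa2.
  have s2 := Lfun2_lin (- (2 * r)) sa s1.
  have ge0 : forall x, 0 <= - (2 * r) * a x + (r ^+ 2 * 1 + a x ^+ 2).
    move=> x; have := sqr_ge0 (r - a x); rewrite sqrrB; lra.
  have E1 := op_re_lin P (r ^+ 2) (Lfun2_cst mu 1) sa2.
  have E2 := op_re_lin P (- (2 * r)) sa s1.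
  apply: filterS2 (filterI (op_re_ge0 P0 s2 ge0) op_re1) (filterI E1 E2).
  by move=> x [+ e1] [e2 e3]; rewrite e3 e2 e1 -/r; lra.
have : {ae mu, forall x, forall n, if @unpickle rat n is Some q then
    2 * ratr q * op_re P a x <= op_re P (fun x => a x ^+ 2) x + ratr q ^+ 2 else true}.
  by apply: ae_foralln => n; case: (unpickle n) => [q|]; [exact: H|exact: aeW].
apply: filterS => x Hx; apply: sqr_le_rat => q.
by have := Hx (pickle q); rewrite pickleK.
Qed.

(** With [u = op_re P a], the pointwise bound [2 u b <= u^2 + b^2] and Jensen's inequality reduce
    the claim to the integral of P(a^2), which equals that of a^2 because [P] preserves
    integrals. *)
Lemma form_le_bounded a b : a \in sq -> (fun x => a x ^+ 2) \in sq -> b \in sq ->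
  form P a b <= 2^-1 * (\int[mu]_x (a x ^+ 2) + \int[mu]_x (b x ^+ 2)).
Proof.
move=> sa sa2 sb; rewrite -(form1r PBS sa2) formE// formE ?Lfun2_cst//.
have sP := op_re_Lfun P.
under [X in _ <= 2^-1 * (X + _)]eq_Rintegral do rewrite mulr1.
have -> : 2^-1 * (\int[mu]_x op_re P (fun x => a x ^+ 2) x + \int[mu]_x (b x ^+ 2)) =
    \int[mu]_x (2^-1 * op_re P (fun x => a x ^+ 2) x + 2^-1 * (b x ^+ 2)).
  rewrite Rintegral_lin; last 2 first.
  - exact: Lfun21.
  - by apply: Lfun1Z; exact: Lfun2_sqr.
  rewrite RintegralZl// ?mulrDr//; apply/Lfun1_integrable; exact: Lfun2_sqr.
apply: ae_le_Rintegral.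
- exact: Lfun2_mul.
- apply: Lfun1_lin; first exact: Lfun21.
  by apply: Lfun1Z; exact: Lfun2_sqr.
- apply: filterS (op_re_sqr_le sa sa2) => x.
  by have := sqr_ge0 (op_re P a x - b x); rewrite sqrrB; lra.
Qed.

Let truncate_sqr_Lfun a n : a \in sq -> (forall x, 0 <= a x) ->
  (fun x => truncate a n x ^+ 2) \in sq.
Proof.
move=> sa a0; apply: (@Lfun2_bounded _ _ _ _ _ (n%:R ^+ 2)) => [|x].
  apply: measurable_funX; apply: measurable_truncate; exact: Lfun_measurable sa.
rewrite ger0_norm ?sqr_ge0// lerXn2r ?nnegrE ?truncate_ge0//.
by rewrite ge_min lexx orbT.
Qed.

Let truncate_sqr_le a n : a \in sq -> (forall x, 0 <= a x) ->
  \int[mu]_x (truncate a n x ^+ 2) <= \int[mu]_x (a x ^+ 2).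
Proof.
move=> sa a0; apply: ae_le_Rintegral.
- by apply: Lfun2_sqr; exact: truncate_Lfun.
- exact: Lfun2_sqr.
- by apply: aeW => x; rewrite lerXn2r ?nnegrE ?truncate_ge0// truncate_le.
Qed.

(** [b] is truncated first: against a function bounded by [m], replacing [a] by [truncate a n] costs
    at most [m] times the integral of the difference, again because [P] preserves integrals. Then
    [n] tends to infinity, and [m] after it; continuity of [P] is never invoked. *)
Lemma form_le a b : a \in sq -> b \in sq -> (forall x, 0 <= a x) -> (forall x, 0 <= b x) ->
  form P a b <= 2^-1 * (\int[mu]_x (a x ^+ 2) + \int[mu]_x (b x ^+ 2)).
Proof.
move=> sa sb a0 b0; set C := 2^-1 * _.
rewrite formE//; apply: (cvgr_to_le (truncate_Rintegral_cvg sb (op_re_Lfun P a) b0)).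
apply: nearW => m; set bm := truncate b m.
have sbm : bm \in sq by exact: truncate_Lfun.
have bm0 x : 0 <= bm x by exact: truncate_ge0.
have step n : form P a bm <= C + m%:R * (\int[mu]_x a x - \int[mu]_x truncate a n x).
  pose e x := a x - truncate a n x.
  have san := truncate_Lfun n sa a0.
  have se : e \in sq by exact: Lfun2B.
  have e0 x : 0 <= e x by rewrite subr_ge0 truncate_le.
  have -> : form P a bm = form P (truncate a n) bm + form P e bm.
    rewrite -formDl//; congr form.
    by apply/funext => x; rewrite /e addrC subrK.
  apply: lerD.
    apply: le_trans (form_le_bounded san (truncate_sqr_Lfun n sa a0) sbm) _.
    by rewrite ler_wpM2l ?invr_ge0// lerD ?truncate_sqr_le.
  have -> : \int[mu]_x a x - \int[mu]_x truncate a n x = form P e (fun=> 1).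
    by rewrite (form1r PBS se) RintegralB//; apply/Lfun1_integrable; exact: Lfun21.
  rewrite -formZr ?Lfun2_cst// -subr_ge0 -formBr//; last first.
    by apply: Lfun2Z; exact: Lfun2_cst.
  apply: form_ge0 => // [|x]; first by apply: Lfun2B => //; apply: Lfun2Z; exact: Lfun2_cst.
  by rewrite mulr1 subr_ge0 ge_min lexx orbT.
have lim : C + m%:R * (\int[mu]_x a x - \int[mu]_x truncate a n x) @[n --> \oo] --> C.
  rewrite -[X in _ --> X]addr0 -(mulr0 m%:R) -(subrr (\int[mu]_x a x)).
  apply: cvgD; first exact: cvg_cst.
  apply: cvgMr; apply: cvgB; first exact: cvg_cst.
  have E1 (f : X -> R) : \int[mu]_x (1 * f x) = \int[mu]_x f x.
    by apply: eq_Rintegral => x _; rewrite mul1r.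
  have := truncate_Rintegral_cvg sa (Lfun2_cst mu 1) a0; rewrite E1.
  by rewrite (_ : (fun n => _) = (fun n => \int[mu]_x truncate a n x))//;
    apply/funext => n; rewrite E1.
apply: (cvgr_to_ge lim); apply: nearW => n.
by have := step n; rewrite formE.
Qed.

End bistochastic.

(* Scale [a] by [t] and [b] by [1/t] in [form_le]. *)
Lemma form_small b e : b \in sq -> (forall x, 0 <= b x) -> 0 < e ->
  exists2 D, 0 < D & forall P, bistochastic P -> forall a, a \in sq ->
    (forall x, 0 <= a x) -> \int[mu]_x (a x ^+ 2) <= D ->
    form P a b <= e /\ form P b a <= e.
Proof.
move=> sb b0 e0; pose I2 c := \int[mu]_x (c x ^+ 2).
have I20 c : 0 <= I2 c by apply: Rintegral_ge0 => x _; exact: sqr_ge0.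
(* This gives [I2 b <= e * t <= e * t ^+ 2], so [b] divided by [t] has squared norm at most [e]; the
   bound [e / t ^+ 2] chosen for [a] does the same for [t * a]. *)
pose t := 1 + I2 b / e.
have t1 : 1 <= t by rewrite lerDl divr_ge0// ltW.
have t0 : 0 < t by exact: lt_le_trans ltr01 t1.
exists (e / t ^+ 2); first by rewrite divr_gt0// exprn_gt0.
move=> P PBS a sa a0 aD.
have sqrZ r c : c \in sq -> I2 (fun x => r * c x) = r ^+ 2 * I2 c.
  move=> sc; rewrite /I2 -RintegralZl//; last exact/Lfun1_integrable/Lfun2_sqr.
  by apply: eq_Rintegral => x _; rewrite exprMn.
have ta : I2 (fun x => t * a x) <= e.
  by rewrite sqrZ// mulrC -ler_pdivlMr// exprn_gt0.
have tb : I2 (fun x => t^-1 * b x) <= e.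
  rewrite sqrZ// exprVn mulrC ler_pdivrMr ?exprn_gt0//.
  apply: (@le_trans _ _ (e * t)).
    by rewrite /t mulrDr mulr1 mulrCA divff ?gt_eqF// mulr1 lerDr ltW.
  by rewrite ler_pM2l// expr2 ler_peMl// ltW.
have sta : (fun x => t * a x) \in sq by exact: Lfun2Z.
have stb : (fun x => t^-1 * b x) \in sq by exact: Lfun2Z.
have ta0 x : 0 <= t * a x by rewrite mulr_ge0// ltW.
have tb0 x : 0 <= t^-1 * b x by rewrite mulr_ge0// invr_ge0 ltW.
have half : 2^-1 * (I2 (fun x => t * a x) + I2 (fun x => t^-1 * b x)) <= e.
  by rewrite ler_pdivrMl// mulr_natl mulr2n lerD.
split.
- have -> : form P a b = form P (fun x => t * a x) (fun x => t^-1 * b x).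
    by rewrite formZl// formZr// mulrA divff ?mul1r// gt_eqF.
  exact: le_trans (form_le PBS sta stb ta0 tb0) half.
- have -> : form P b a = form P (fun x => t^-1 * b x) (fun x => t * a x).
    by rewrite formZl// formZr// mulrA mulVf ?mul1r// gt_eqF.
  by apply: le_trans (form_le PBS stb sta tb0 ta0) _; rewrite addrC.
Qed.

End contraction.

Section simple_approximation.
Context d (X : measurableType d) (R : realType) (mu : probability X R).
Local Notation sq := (Lfun mu 2%:E).
Implicit Types (a b c : X -> R) (L : seq (R * set X)).

Definition lincomb L : X -> R := fun x => \sum_(p <- L) p.1 * \1_(p.2) x.

Definition measurable_seq L := forall p, p \in L -> measurable p.2.

Lemma lincomb_cons p L : lincomb (p :: L) = fun x => p.1 * \1_(p.2) x + lincomb L x.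
Proof. by apply/funext => x; rewrite /lincomb big_cons. Qed.

Lemma measurable_seq_cons p L : measurable_seq (p :: L) <->
  measurable p.2 /\ measurable_seq L.
Proof.
split=> [H|[H1 H2] q]; last by rewrite inE => /orP[/eqP->|/H2].
by split=> [|q qL]; apply: H; rewrite inE ?eqxx// qL orbT.
Qed.

Lemma lincomb_Lfun L : measurable_seq L -> lincomb L \in sq.
Proof.
elim: L => [_|p L IHL /measurable_seq_cons[mp mL]].
  rewrite (_ : lincomb _ = fun=> 0) ?Lfun2_cst//.
  by apply/funext => x; rewrite /lincomb big_nil.
by rewrite lincomb_cons; apply: Lfun2_lin; [exact: Lfun2_indic|exact: IHL].
Qed.

Import HBNNSimple.

(** Approximation from below keeps [a - lincomb L] nonnegative, as the use of [form_small] and of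
    positivity requires. *)
Lemma simple_approximation a (D : R) : a \in sq -> (forall x, 0 <= a x) -> 0 < D ->
  exists L, [/\ measurable_seq L, forall x, 0 <= lincomb L x <= a x &
    \int[mu]_x ((a x - lincomb L x) ^+ 2) <= D].
Proof.
move=> sa a0 D0; have ma := Lfun_measurable sa.
pose f := EFin \o a; have mf : measurable_fun setT f by exact/measurable_EFinP.
have f0 x : setT x -> (0 <= f x)%E by rewrite lee_fin.
pose g n : X -> R := nnsfun_approx measurableT mf n.
have ga n x : g n x <= a x.
  by rewrite /g nnsfun_approxE -lee_fin; exact: le_approx.
have g0 n x : 0 <= g n x by rewrite /g.
have gcvg x : g n x @[n --> \oo] --> a x.
  by have /fine_cvg := cvg_nnsfun_approx measurableT mf f0 (x := x) I.
have cvg0 : \int[mu]_x ((a x - g n x) ^+ 2) @[n --> \oo] --> (0 : R).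
  rewrite (_ : 0 = \int[mu]_x (0 : R)); last by rewrite Rintegral_cst// mul0r.
  apply: (@Rdominated_cvg _ _ _ _ _ _ (fun x => a x ^+ 2)).
  - by move=> n; apply: measurable_funX; apply: measurable_funB.
  - move=> x; have gx : a x - g n x @[n --> \oo] --> a x - a x.
      by apply: cvgB; [exact: cvg_cst|exact: gcvg].
    by have := cvgM gx gx; rewrite subrr mulr0; exact.
  - move=> n x; rewrite ger0_norm ?sqr_ge0// lerXn2r ?nnegrE ?subr_ge0//.
    by rewrite gerBl.
  - exact: Lfun2_sqr.
have [n _ /(_ n (leqnn _)) /= nD] := cvgr_lt _ cvg0 _ D0.
pose s : {nnsfun X >-> R} := nnsfun_approx measurableT mf n.
pose L := [seq (r, s @^-1` [set r]) | r <- finmap.enum_fset (fset_set (range s))].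
have LE : lincomb L = g n.
  apply/funext => x; rewrite /lincomb big_map /g -/s fimfunE fsbig_finite//=.
exists L; split.
- by move=> _ /mapP[r _ ->] /=.
- by move=> x; rewrite LE g0 ga.
- by rewrite LE ltW.
Qed.

End simple_approximation.

(** * Uniform control of the form by finitely many sets *)

Section form_approximation.
Context d (X : measurableType d) (R : realType) (mu : probability X R).
Variable k : scalar_kind.
Local Notation L2 := (L2 mu k).
Local Notation sq := (Lfun mu 2%:E).
Implicit Types (a b c : X -> R) (P Q : {linear L2 -> L2}) (l : seq (set X)).

Definition set_form P (A B : set X) : R := form P \1_A \1_B.

Definition agree_on l P Q := forall A B, A \in l -> B \in l ->
  set_form P A B = set_form Q A B.

Lemma agree_on_cat l l' P Q : agree_on (l ++ l') P Q ->
  agree_on l P Q /\ agree_on l' P Q.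
Proof.
by move=> H; split=> A B lA lB; apply: H; rewrite mem_cat ?lA ?lB ?orbT.
Qed.

Lemma form_lincomb P L c : measurable_seq L -> c \in sq ->
  form P (lincomb L) c = \sum_(p <- L) p.1 * form P \1_(p.2) c.
Proof.
move=> + sc; elim: L => [_|p L IHL /measurable_seq_cons[mp mL]].
  rewrite big_nil (_ : lincomb _ = fun=> 0) ?form0l//.
  by apply/funext => x; rewrite /lincomb big_nil.
rewrite lincomb_cons big_cons form_linl//; last exact: lincomb_Lfun.
  by rewrite IHL.
exact: Lfun2_indic.
Qed.

Lemma form_lincombr P L a : measurable_seq L ->
  form P a (lincomb L) = \sum_(p <- L) p.1 * form P a \1_(p.2).
Proof.
elim: L => [_|p L IHL /measurable_seq_cons[mp mL]].
  rewrite big_nil (_ : lincomb _ = fun=> 0) ?form0r//.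
  by apply/funext => x; rewrite /lincomb big_nil.
rewrite lincomb_cons big_cons form_linr//; last exact: lincomb_Lfun.
  by rewrite IHL.
exact: Lfun2_indic.
Qed.

Lemma agree_lincomb P Q L L' : measurable_seq L -> measurable_seq L' ->
  agree_on (unzip2 L ++ unzip2 L') P Q ->
  form P (lincomb L) (lincomb L') = form Q (lincomb L) (lincomb L').
Proof.
move=> mL mL' PQ; rewrite !form_lincomb ?lincomb_Lfun//.
apply: eq_big_seq => p pL; congr (_ * _).
rewrite !form_lincombr//; apply: eq_big_seq => q qL'; congr (_ * _).
by apply: PQ; rewrite mem_cat; apply/orP; [left|right]; exact: map_f.
Qed.

Let form_approx_on a b := forall e, 0 < e -> exists l, (forall A, A \in l -> measurable A) /\
  forall P Q, bistochastic P -> bistochastic Q -> agree_on l P Q ->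
  `|form P a b - form Q a b| <= e.

Let form_approx_ge0 a b : a \in sq -> b \in sq -> (forall x, 0 <= a x) ->
  (forall x, 0 <= b x) -> form_approx_on a b.
Proof.
move=> sa sb a0 b0 e e0; have e4 : 0 < e / 4 by rewrite divr_gt0.
have [D D0 DP] := form_small k sb b0 e4.
have [D' D'0 DP'] := form_small k sa a0 e4.
have [L [mL La LD]] := simple_approximation sa a0 D0.
have [L' [mL' Lb LD']] := simple_approximation sb b0 D'0.
exists (unzip2 L ++ unzip2 L'); split.
  by move=> A; rewrite mem_cat => /orP[] /mapP[p pL ->]; [exact: mL|exact: mL'].
have sL := lincomb_Lfun mu mL; have sL' := lincomb_Lfun mu mL'.
have L0 x : 0 <= lincomb L x by case/andP: (La x).
have L'0 x : 0 <= lincomb L' x by case/andP: (Lb x).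
have half P : bistochastic P ->
    0 <= form P a b - form P (lincomb L) (lincomb L') <= e / 2.
  move=> PBS; have P0 : positive_operator P by case: PBS.
  have saL := Lfun2B sa sL; have sbL := Lfun2B sb sL'.
  have aL0 x : 0 <= a x - lincomb L x by rewrite subr_ge0; case/andP: (La x).
  have bL0 x : 0 <= b x - lincomb L' x by rewrite subr_ge0; case/andP: (Lb x).
  have -> : form P a b - form P (lincomb L) (lincomb L') =
      form P (fun x => a x - lincomb L x) b +
      form P (lincomb L) (fun x => b x - lincomb L' x).
    by rewrite formBl// formBr//; ring.
  have H1 := (DP P PBS _ saL aL0 LD).1.
  (* Since [lincomb L] lies below [a], the estimate for the fixed function [a] applies, and the
     accuracy of [L'] can be chosen independently of [L]. *)
  have H2 : form P (lincomb L) (fun x => b x - lincomb L' x) <= e / 4.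
    apply: le_trans (DP' P PBS _ sbL bL0 LD').2.
    by rewrite -subr_ge0 -formBl//; exact: form_ge0.
  rewrite addr_ge0 ?form_ge0//=.
  lra.
move=> P Q PBS QBS /(agree_lincomb mL mL') PQ.
have := half P PBS; have := half Q QBS; rewrite PQ => /andP[h1 h2] /andP[h3 h4].
rewrite ler_norml; lra.
Qed.

Let form_approx_subl a a' b : a \in sq -> a' \in sq -> b \in sq ->
  form_approx_on a b -> form_approx_on a' b -> form_approx_on (fun x => a x - a' x) b.
Proof.
move=> sa sa' sb ab a'b e e0; have e2 : 0 < e / 2 by rewrite divr_gt0.
have [l [ml lP]] := ab _ e2; have [l' [ml' lP']] := a'b _ e2.
exists (l ++ l'); split; first by move=> A; rewrite mem_cat => /orP[/ml|/ml'].
move=> P Q PBS QBS /agree_on_cat[PQ PQ']; rewrite !formBl//.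
have := lP P Q PBS QBS PQ; have := lP' P Q PBS QBS PQ'; rewrite !ler_norml.
by move=> /andP[? ?] /andP[? ?]; lra.
Qed.

Let form_approx_subr a b b' : b \in sq -> b' \in sq ->
  form_approx_on a b -> form_approx_on a b' -> form_approx_on a (fun x => b x - b' x).
Proof.
move=> sb sb' ab a'b e e0; have e2 : 0 < e / 2 by rewrite divr_gt0.
have [l [ml lP]] := ab _ e2; have [l' [ml' lP']] := a'b _ e2.
exists (l ++ l'); split; first by move=> A; rewrite mem_cat => /orP[/ml|/ml'].
move=> P Q PBS QBS /agree_on_cat[PQ PQ']; rewrite !formBr//.
have := lP P Q PBS QBS PQ; have := lP' P Q PBS QBS PQ'; rewrite !ler_norml.
by move=> /andP[? ?] /andP[? ?]; lra.
Qed.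

(* Uniformity in [P] and [Q] is what makes exact agreement on finitely many
   indicators a weak neighbourhood condition. *)
Lemma form_approximation a b e : a \in sq -> b \in sq -> 0 < e ->
  exists l, (forall A, A \in l -> measurable A) /\
  forall P Q, bistochastic P -> bistochastic Q -> agree_on l P Q ->
  `|form P a b - form Q a b| <= e.
Proof.
move=> sa sb; have norm_sq f : f \in sq -> (fun x => `|f x|) \in sq.
  move=> sf; apply: (Lfun2_le _ _ sf) => [|x]; last by rewrite normr_id.
  by apply: measurableT_comp => //; exact: Lfun_measurable sf.
have E (f : X -> R) : f = (fun x => `|f x| - (`|f x| - f x)).
  by apply/funext => x; rewrite opprB addrC subrK.
have subN0 (f : X -> R) x : 0 <= `|f x| - f x by rewrite subr_ge0 ler_norm.
have sN (f : X -> R) : f \in sq -> (fun x => `|f x| - f x) \in sq.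
  by move=> sf; apply: Lfun2B => //; exact: norm_sq.
have sna := norm_sq _ sa; have snb := norm_sq _ sb.
have sNa := sN _ sa; have sNb := sN _ sb.
suff : form_approx_on a b by exact.
rewrite (E a) (E b); apply: form_approx_subl; rewrite -?(E b)//.
- by rewrite (E b); apply: form_approx_subr => //; apply: form_approx_ge0.
- by rewrite (E b); apply: form_approx_subr => //; apply: form_approx_ge0.
Qed.

Lemma set_form_coupling P : bistochastic P -> coupling mu (set_form P).
Proof.
move=> PBS; have P0 : positive_operator P by case: PBS.
have indicU (A B : set X) : A `&` B = set0 ->
    (\1_(A `|` B) : X -> R) = (fun x => \1_A x + \1_B x).
  move=> AB; apply/funext => x; rewrite !indicE in_setU.
  case: (boolP (x \in A)) => [xA|_]; last by rewrite add0r.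
  case: (boolP (x \in B)) => [xB|_]; last by rewrite addr0.
  have xAB : (A `&` B) x by split; exact: set_mem.
  by rewrite AB in xAB.
have indicT : (\1_setT : X -> R) = fun=> 1.
  by apply/funext => x; rewrite indicE in_setT.
split.
- by move=> A B mA mB; apply: form_ge0 => //; exact: Lfun2_indic.
- move=> B mB A A' mA mA' AA'; rewrite /set_form indicU// formDl//; exact: Lfun2_indic.
- move=> A mA B B' mB mB' BB'; rewrite /set_form indicU// formDr//; exact: Lfun2_indic.
- move=> A mA; rewrite /set_form indicT form1r ?Rintegral_indic//; exact: Lfun2_indic.
- move=> B mB; rewrite /set_form indicT form1l ?Rintegral_indic//; exact: Lfun2_indic.
Qed.

Lemma koopman_set_form T P A B : measure_preserving mu T -> is_koopman T P ->
  measurable A -> measurable B -> set_form P A B = pr mu (T @^-1` A `&` B).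
Proof.
move=> Tmp PT mA mB.
have mTA : measurable (T @^-1` A) by rewrite -[X in measurable X]setTI; exact: Tmp.1.
rewrite -Rintegral_indic; last exact: measurableI.
rewrite /set_form formE; last exact: Lfun2_indic.
apply: ae_eq_Rintegral.
- apply: (@Lfun1_meas _ _ _ mu); apply: Lfun2_mul; first exact: op_re_Lfun.
  exact: Lfun2_indic.
- by apply: measurable_indic; exact: measurableI.
- apply: filterS2 (PT (iota mu k \1_A)) (mp_ae Tmp (iotaE k (Lfun2_indic mu mA))).
  move=> x e1 e2; rewrite /op_re e1 e2 scalar_re_mk !indicE in_setI.
  rewrite (_ : (x \in T @^-1` A) = (T x \in A)); last by apply/idP/idP; rewrite !inE.
  by case: (_ \in A); rewrite ?mul1r ?mul0r.
Qed.

(** Equality on indicators passes to the whole form through [form_approximation] with arbitrary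
    error. Testing it against the difference of [op_re P a] and [op_re Q a] shows that the square of
    this difference has integral zero. *)
Lemma set_form_inj P Q : bistochastic P -> bistochastic Q ->
  (forall A B, measurable A -> measurable B -> set_form P A B = set_form Q A B) ->
  P =1 Q.
Proof.
move=> PBS QBS PQ; have P0 : positive_operator P by case: PBS.
have Q0 : positive_operator Q by case: QBS.
have formPQ a b : a \in sq -> b \in sq -> form P a b = form Q a b.
  move=> sa sb; apply/eqP; rewrite -subr_eq0 -normr_le0; apply/ler_addgt0Pl => e e0.
  have [l [ml lP]] := form_approximation sa sb e0.
  by rewrite addr0; apply: lP => // A B lA lB; apply: PQ; exact: ml.
have opPQ a : a \in sq -> {ae mu, forall x, op_re P a x = op_re Q a x}.
  move=> sa; pose h x := op_re P a x - op_re Q a x.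
  have sh : h \in sq by apply: Lfun2B; exact: op_re_Lfun.
  have : \int[mu]_x (h x ^+ 2) = 0.
    rewrite -[RHS](subrr (form P a h)) {2}formPQ// !formE//.
    rewrite -RintegralB//; last 2 first.
    - by apply/Lfun1_integrable; apply: Lfun2_mul => //; exact: op_re_Lfun.
    - by apply/Lfun1_integrable; apply: Lfun2_mul => //; exact: op_re_Lfun.
    by apply: eq_Rintegral => x _; rewrite -mulrBl expr2.
  move=> h0; have ih : mu.-integrable setT (EFin \o (fun x => h x ^+ 2)).
    exact/Lfun1_integrable/Lfun2_sqr.
  have : (\int[mu]_x `|(h x ^+ 2)%:E| = 0)%E.
    under eq_integral do rewrite gee0_abs ?lee_fin ?sqr_ge0//.
    by rewrite -[LHS]fineK ?integrable_fin_num//; congr EFin.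
  have mh : measurable_fun setT (EFin \o (fun x => h x ^+ 2)) by exact: measurable_int ih.
  move/(ae_eq_integral_abs mu measurableT mh); apply: filterS => x /(_ I) /= [].
  by move=> /eqP; rewrite sqrf_eq0 subr_eq0 => /eqP.
move=> f; apply: L2P.
apply: filterS2 (filterI (op_decomp P0 f) (op_decomp Q0 f))
  (filterI (opPQ _ (L2_re_Lfun f)) (opPQ _ (L2_im_Lfun f))).
by move=> x [[p1 p2] [q1 q2]] [e1 e2]; apply: scalar_eq; rewrite ?p1 ?p2 ?q1 ?q2.
Qed.

Lemma is_koopman_set_form T P : bistochastic P -> measure_preserving mu T ->
  (forall A B, measurable A -> measurable B ->
    set_form P A B = pr mu (T @^-1` A `&` B)) -> is_koopman T P.
Proof.
move=> PBS Tmp PT; have [Q QT] := koopman_in_BS k Tmp.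
have QBS : bistochastic (\val Q) := is_koopman_bistochastic Tmp QT.
have PQ : P =1 \val Q.
  by apply: set_form_inj => // A B mA mB; rewrite PT// (koopman_set_form Tmp QT).
by move=> f; rewrite PQ; exact: QT.
Qed.

End form_approximation.

(** * The weak operator topology *)

Section scalar_topology.
Context (R : realType) (k : scalar_kind).
Local Notation K := (scalar_field R k).

Lemma cvg_scalar_re T (F : set_system T) (h : T -> K) (z : K) : Filter F ->
  h t @[t --> F] --> z -> scalar_re (h t) @[t --> F] --> scalar_re z.
Proof.
move=> FF; case: k h z => h z hz; first exact: hz.
apply/cvgrPdist_lt => e e0.
have e0' : 0 < e%:C%C by rewrite ltcR.
have /cvgrPdist_lt/(_ _ e0') := hz; apply: filterS => t /=.
by rewrite -ltcR; apply: le_lt_trans; rewrite -raddfB; exact: normc_ge_Re.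
Qed.

Lemma cvg_scalar_mk T (F : set_system T) (u v : T -> R) (a b : R) : Filter F ->
  u t @[t --> F] --> a -> v t @[t --> F] --> b ->
  scalar_mk k (u t) (v t) @[t --> F] --> scalar_mk k a b.
Proof.
move=> FF; case: k => ua vb; first exact: ua.
apply/cvgrPdist_lt => e; rewrite ltcE /= => /andP[/eqP e1 e2].
have e4 : 0 < complex.Re e / 2 by rewrite divr_gt0.
move/cvgrPdist_lt : ua => /(_ _ e4) ua; move/cvgrPdist_lt : vb => /(_ _ e4) vb.
apply: filterS2 ua vb => t ua vb.
rewrite normc_def ltcE /= e1 eqxx /=.
rewrite (@le_lt_trans _ _ (`|a - u t| + `|b - v t|))//; last first.
  by rewrite [ltRHS]splitr ltrD.
rewrite -[leRHS]ger0_norm ?addr_ge0// -sqrtr_sqr ler_wsqrtr//.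
rewrite [leRHS]sqrrD !real_normK ?num_real//=.
by rewrite -addrA lerD2l lerDr mulrn_wge0// mulr_ge0.
Qed.

End scalar_topology.

(** * Koopman operators in the weak operator topology *)

Section main.
Context d (X : measurableType d) (R : realType) (mu : probability X R).
Variable k : scalar_kind.
Hypotheses (sX : standard_borel X R) (hmu : nonatomic mu).
Local Notation sq := (Lfun mu 2%:E).
Local Notation BS := (BS mu k).
Local Notation operator := (operator mu k).

Lemma set_form_continuous A B : continuous (fun P : BS => set_form (\val P) A B).
Proof.
move=> P; have FF : Filter (nbhs P) by exact: nbhs_filter.
apply: (cvg_scalar_re (F := nbhs P)).
have cval : (fun Q : BS => \val Q : operator) @ P --> (\val P : operator).
  exact: (@initial_continuous _ _ (set_val : BS -> operator)).
have /operator_cvgP/(_ (iota mu k \1_A) (iota mu k \1_B)) H := cval.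
exact: H.
Qed.

Definition near_rel (e : R) (A E : set X) : set BS :=
  [set P | set_form (\val P) A (~` E) + set_form (\val P) (~` A) E < e].

Lemma near_rel_open e A E : open (near_rel e A E).
Proof.
pose h (P : BS) : R := set_form (\val P) A (~` E) + set_form (\val P) (~` A) E.
rewrite (_ : near_rel e A E = h @^-1` `]-oo, e[%classic); last first.
  by apply/seteqP; split=> P /=; rewrite in_itv.
apply: open_comp => [P _|]; last exact: interval_open.
have FF : Filter (nbhs P) by exact: nbhs_filter.
apply: (cvgD (F := nbhs P)); [exact: (@set_form_continuous A (~` E) P)|].
exact: (@set_form_continuous (~` A) E P).
Qed.

Let BSP (P : BS) : bistochastic (\val P). Proof. exact: set_valP. Qed.

Let eps m : R := m.+1%:R^-1.

Let eps_gt0 m : 0 < eps m. Proof. by rewrite invr_gt0. Qed.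

Let eps_limit gamma A E_ : coupling mu gamma -> measurable A ->
  (forall m : nat, measurable (E_ m) /\
    gamma A (~` E_ m) + gamma (~` A) (E_ m) < eps m) ->
  exists E, coupling_rel gamma A E.
Proof.
move=> gP mA EP; apply: (coupling_rel_limit gP mA) => e e0.
have [m _ /(_ m (leqnn _)) me] := near_infty_natSinv_lt (PosNum e0).
have [mE Em] := EP m; exists (E_ m) => //; exact: lt_trans Em me.
Qed.

(** The union runs over uncountably many [E] but is still open; only [A] and [m] are intersected
    over, and these range over countable families. *)
Let approximable (A : set X) (m : nat) : set BS :=
  \bigcup_(E in measurable) near_rel (eps m) A E.

Let coapproximable (A : set X) (m : nat) : set BS :=
  \bigcup_(E in measurable) near_rel (eps m) E A.

Let total_rel gamma : coupling mu gamma -> forall A_ : (set X)^nat,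
  (forall G, sigma_closed G -> (forall n, G (A_ n)) -> forall B, measurable B -> G B) ->
  (forall n, exists E, coupling_rel gamma (A_ n) E) ->
  forall A, measurable A -> exists E, coupling_rel gamma A E.
Proof.
move=> gP A_ Aind AE; have [_ RC RU] := coupling_measure_relation gP.
apply: (Aind [set A | exists E, coupling_rel gamma A E]) => //.
split=> [A [E /RC ?]|B /choice[E /RU ?]]; first by exists (~` E).
by exists (\bigcup_n E n).
Qed.

Lemma koopman_bigcap (A_ : (set X)^nat) : (forall n, measurable (A_ n)) ->
  (forall G, sigma_closed G -> (forall n, G (A_ n)) -> forall B, measurable B -> G B) ->
  koopman mu k = \bigcap_n approximable (A_ (decode n).1) (decode n).2 /\
  koopman_inv mu k = \bigcap_n (approximable (A_ (decode n).1) (decode n).2 `&`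
    coapproximable (A_ (decode n).1) (decode n).2).
Proof.
move=> mA Aind.
have app T (P : BS) A m : measure_preserving mu T -> is_koopman T (\val P) ->
    measurable A -> approximable A m P.
  move=> Tmp PT mB; have mT : measurable (T @^-1` A).
    by rewrite -[X in measurable X]setTI; exact: Tmp.1.
  exists (T @^-1` A) => //; rewrite /near_rel/=.
  rewrite !(koopman_set_form Tmp PT)//; try exact: measurableC.
  by rewrite preimage_setC setICr setICl pr0 addr0.
have koop (P : BS) T : measure_preserving mu T ->
    (forall A E, coupling_rel (set_form (\val P)) A E -> null_equal mu (T @^-1` A) E) ->
    (forall A, measurable A -> exists E, coupling_rel (set_form (\val P)) A E) ->
    is_koopman T (\val P).
  move=> Tmp TP tot; apply: is_koopman_set_form => // A B mB mB'.
  have [E AE] := tot A mB; have [_ mE _ _] := AE.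
  rewrite (coupling_relE (set_form_coupling (BSP P)) AE)//.
  have mT : measurable (T @^-1` A) by rewrite -[X in measurable X]setTI; exact: Tmp.1.
  apply: pr_null_equal; [exact: measurableI|exact: measurableI|].
  by apply: filterS (TP _ _ AE) => x TE; split=> -[/TE ? ?].
have tot (P : BS) : (forall n m, approximable (A_ n) m P) ->
    forall A, measurable A -> exists E, coupling_rel (set_form (\val P)) A E.
  move=> PA; apply: (total_rel (set_form_coupling (BSP P)) Aind) => n.
  have /choice[E_ EP] : forall m, exists E, measurable E /\ near_rel (eps m) (A_ n) E P.
    by move=> m; have [E mE EP] := PA n m; exists E.
  exact: (eps_limit (set_form_coupling (BSP P)) (mA n) EP).
have cotot (P : BS) : (forall n m, coapproximable (A_ n) m P) ->
    forall A, measurable A -> exists E, coupling_rel (set_form (\val P)) E A.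
  move=> PA A mB; have gP := coupling_sym (set_form_coupling (BSP P)).
  suff [E /coupling_rel_sym EA] :
    exists E, coupling_rel (fun A B => set_form (\val P) B A) A E by exists E.
  apply: (total_rel gP Aind) mB => n.
  have /choice[E_ EP] : forall m, exists E, measurable E /\ near_rel (eps m) E (A_ n) P.
    by move=> m; have [E mE EP] := PA n m; exists E.
  apply: (eps_limit (E_ := E_) gP (mA n)) => m; split; first exact: (EP m).1.
  by rewrite addrC; exact: (EP m).2.
split; apply/seteqP; split=> P.
- by move=> [T Tmp PT] n _; exact: (app _ _ _ _ Tmp PT (mA _)).
- move=> PA; have {}PA n m : approximable (A_ n) m P.
    by have := PA (pickle (n, m)) I; rewrite decodeK.
  have [T Tmp TP] := realization sX (coupling_measure_relation
    (set_form_coupling (BSP P))) (tot P PA).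
  by exists T => //; apply: koop => //; exact: tot.
- move=> [T [Tmp [S Smp ST]] PT] n _; split; first exact: (app _ _ _ _ Tmp PT (mA _)).
  move: (decode n) => [i j] /=.
  have mS : measurable (S @^-1` A_ i) by rewrite -[X in measurable X]setTI; exact: Smp.1.
  have mT E : measurable E -> measurable (T @^-1` E).
    by move=> mE; rewrite -[X in measurable X]setTI; exact: Tmp.1.
  (* As [S (T x) = x] almost everywhere, the preimage of this set under [T] is [A_ i] up to a null
     set, and both error terms vanish. *)
  exists (S @^-1` A_ i) => //; rewrite /near_rel/=.
  rewrite !(koopman_set_form Tmp PT)//; try exact: measurableC.
  have null (C : set X) : measurable C -> {ae mu, forall x, ~ C x} -> pr mu C = 0.
    move=> mC C0; rewrite -(pr0 mu); apply: pr_null_equal => //.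
    by apply: filterS C0 => x; split.
  rewrite !null ?addr0//.
  + by apply: measurableI => //; apply: mT; exact: measurableC.
  + by apply: filterS ST => x [STx _]; rewrite /setC/= STx; tauto.
  + by apply: measurableI; [exact: mT|exact: measurableC].
  + by apply: filterS ST => x [STx _]; rewrite /setC/= STx; tauto.
- move=> PA; have PA1 n m : approximable (A_ n) m P.
    by have := (PA (pickle (n, m)) I).1; rewrite decodeK.
  have PA2 n m : coapproximable (A_ n) m P.
    by have := (PA (pickle (n, m)) I).2; rewrite decodeK.
  have [T [Tmp Tinv TP]] := realization_invertible sX (coupling_measure_relation
    (set_form_coupling (BSP P))) (tot P PA1) (cotot P PA2).
  by exists T => //; apply: koop => //; exact: tot.
Qed.

Let approximable_open A m : open (approximable A m).
Proof. by apply: bigcup_open => E _; exact: near_rel_open. Qed.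

Let coapproximable_open A m : open (coapproximable A m).
Proof. by apply: bigcup_open => E _; exact: near_rel_open. Qed.

Lemma koopman_Gdelta : Gdelta (koopman mu k).
Proof.
have [A [mA Aind _]] := standard_borel_generators sX.
have [-> _] := koopman_bigcap mA Aind.
by exists (fun n => approximable (A (decode n).1) (decode n).2).
Qed.

Lemma koopman_inv_Gdelta : Gdelta (koopman_inv mu k).
Proof.
have [A [mA Aind _]] := standard_borel_generators sX.
have [_ ->] := koopman_bigcap mA Aind.
exists (fun n => approximable (A (decode n).1) (decode n).2 `&`
  coapproximable (A (decode n).1) (decode n).2) => // n.
exact: openI.
Qed.

Lemma koopman_inv_dense : dense (koopman_inv mu k).
Proof.
move=> O [P OP] [W oW WO].
(* Invertible Koopman operators with exactly the coefficients of [P] on the sets of [l]. The filter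
   generated by these sets converges to [P], so the given open set contains one of them; that it is
   inhabited is then [coupling_realization]. *)
pose base l : set operator := [set Q | bistochastic Q /\ agree_on l Q (\val P) /\
  exists2 T, measure_preserving mu T /\ essentially_invertible mu T & is_koopman T Q].
pose dom := [set l : seq (set X) | forall A, A \in l -> measurable A].
pose F := filter_from dom base.
have FF : Filter F.
  apply: filter_from_filter; first by exists [::].
  move=> l l' ml ml'; exists (l ++ l').
    by move=> A; rewrite mem_cat => /orP[/ml|/ml'].
  by move=> Q [QBS [/agree_on_cat[Ql Ql'] QT]].
pose opform (Q : operator) := form (Q : {linear L2 mu k -> L2 mu k}).
have cvg_form a b : a \in sq -> b \in sq ->
    opform Q a b @[Q --> F] --> form (\val P) a b.
  move=> sa sb; apply/cvgrPdist_le => e e0.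
  have [l [ml lP]] := form_approximation k sa sb e0.
  exists l => // Q [QBS [QP _]]; apply: lP => //.
  by move=> A B lA lB; rewrite QP.
have FP : F --> (\val P : operator).
  apply/operator_cvgP => f g.
  have [P0 _ _] := BSP P; rewrite (L2_inner_form P0).
  (* [L2_inner_form] speaks of positive operators only, so the coefficient is rewritten eventually
     along [F] and not for every operator. *)
  apply: (@cvg_trans _ (scalar_mk k
    (opform Q (fun x => scalar_re (f x)) (fun x => scalar_re (g x)) +
     opform Q (fun x => scalar_im (f x)) (fun x => scalar_im (g x)))
    (opform Q (fun x => scalar_im (f x)) (fun x => scalar_re (g x)) -
     opform Q (fun x => scalar_re (f x)) (fun x => scalar_im (g x)))
    @[Q --> F])).
    apply: near_eq_cvg; exists [::] => // Q [[Q0 _ _] _].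
    by rewrite (L2_inner_form Q0).
  apply: cvg_scalar_mk; [apply: cvgD|apply: cvgB]; apply: cvg_form;
    first [exact: L2_re_Lfun|exact: L2_im_Lfun].
have WP : W (\val P) by rewrite -WO in OP.
have [l ml lW] : F W by apply: FP; exact: open_nbhs_nbhs.
have [T [Tmp Tinv TP]] := coupling_realization sX hmu (set_form_coupling (BSP P)) ml.
have [Q QT] := koopman_in_BS k Tmp.
exists Q; split; last by exists T.
rewrite -WO; apply: lW; split; first exact: BSP.
split; last by exists T.
move=> A B lA lB; rewrite -TP//; apply: koopman_set_form => //; exact: ml.
Qed.

End main.

Theorem theorem1p2 (R : realType) (k : scalar_kind) (d : measure_display)
    (X : measurableType d) (mu : probability X R)
    (hX : standard_borel X R) (hmu : nonatomic mu) :
  (dense (koopman_inv mu k) /\ Gdelta (koopman_inv mu k)) /\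
  (dense (koopman mu k) /\ Gdelta (koopman mu k)).
Proof.
split; (split; [|by [exact: koopman_inv_Gdelta|exact: koopman_Gdelta]]).
  exact: koopman_inv_dense.
move=> O O0 oO; have [Q [OQ [T [Tmp _] QT]]] := koopman_inv_dense hX hmu O0 oO.
by exists Q; split=> //; exists T.
Qed.
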